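(* Let $d\ge 2$ and let $(\mathbf{X}_i)_{i\in\mathbb{Z}}$ be a strictly stationary sequence of $\mathbb{R}^d$-valued random vectors whose common distribution function $F$ has continuous marginal distribution functions $F_1,\dots,F_d$ and copula $C$. Suppose that the sequential empirical process $\alpha_n^{\#}$ converges weakly in $\ell^\infty([0,1]^{d+1})$ to a tight, centered Gaussian field $\mathbb{B}_C^{\#}$ concentrated on $\mathbb{D}_0^{\#}$. a) For any copula $C$ (no smoothness assumption), $$\mathbb{C}_n^+(s,\mathbf{u})=\sqrt{n}\left(C_n^{\#}(s,\mathbf{u})-sC_n(\mathbf{u})\right)+O_{\mathbb{P}}(n^{-1/2})$$ (uniformly in $(s,\mathbf{u})$) converges weakly in $\ell^\infty([0,1]^{d+1})$ to a Gaussian field $\mathbb{G}_C^+$, which may be expressed as $$\mathbb{G}_C^+(s,\mathbf{u})=\mathbb{B}_C^{\#}(s,\mathbf{u})-s\,\mathbb{B}_C^{\#}(1,\mathbf{u}).$$ b) If moreover, for each $p=1,\dots,d$, the partial derivative $\partial_pC(\mathbf{u})$ exists and is continuous on $\{\mathbf{u}\in[0,1]^d: u_p\in(0,1)\}$, then $$\mathbb{C}_n^{\#}(s,\mathbf{u})=\sqrt{n}\left(C_n^{\#}(s,\mathbf{u})-sC(\mathbf{u})\right)+O_{\mathbb{P}}(n^{-1/2})$$ (uniformly in $(s,\mathbf{u})$) converges weakly in $\ell^\infty([0,1]^{d+1})$ to $\mathbb{G}_C^{\#}$, where $$\mathbb{G}_C^{\#}(s,\mathbf{u})=\mathbb{B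}_C^{\#}(s,\mathbf{u})-s\sum_{p=1}^d\partial_pC(\mathbf{u})\,\mathbb{B}_C^{\#}(1,\mathbf{u}^{(p)}).$$
   Context: Notation. $\ell^\infty([0,1]^{k})$ is the space of bounded real functions on $[0,1]^{k}$ with the supremum norm; weak convergence is in the Hoffmann-J\o rgensen sense. $C([0,1]^k)$ denotes the continuous real functions on $[0,1]^k$. Inequalities between vectors are componentwise and $\mathbb{I}$ denotes an indicator. Points of $[0,1]^{d+1}$ are written $(s,\mathbf{u})$ with $s\in[0,1]$, $\mathbf{u}\in[0,1]^d$. Copula. $C$ is the unique distribution function on $[0,1]^d$ with standard uniform univariate marginals such that $F(\mathbf{x})=C(F_1(x_1),\dots,F_d(x_d))$ for all $\mathbf{x}\in\mathbb{R}^d$. Write $\mathbf{X}_i=(X_{i1},\dots,X_{id})$, $U_{ip}=F_p(X_{ip})$, $\mathbf{U}_i=(U_{i1},\dots,U_{id})$. The sequential empirical process is $$\alpha_n^{\#}(s,\mathbf{u})=n^{-1/2}\sum_{i=1}^{\lfloor sn\rfloor}\left(\mathbb{I}\{\mathbf{U}_i\le\mathbf{u}\}-C(\mathbf{u})\right),$$ which equals $\sqrt{n}(G_n^{\#}-C^{\#})(s,\mathbf{u})$ up to a deterministic term that is $O(n^{-1/2})$ uniformly in $(s,\mathbf{u})$, where $G_n^{\#}(s,\mathbf{u})=n^{-1}\sum_{i=1}^{\lfloor sn\rfloor}\mathbb{I}\{\mathbf{U}_i\le\mathbf{u}\}$ and $C^{\#}(s,\mathbf{u})=sC(\mathbf{u})$.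 For a distribution function $H$ on $\mathbb{R}$, its generalized inverse is $H^-(q)=\inf\{x\in\mathbb{R}: H(x)\ge q\}$ for $0<q\le1$ and $H^-(0)=\sup\{x\in\mathbb{R}: H(x)=0\}$. Let $F_n(\mathbf{x})=n^{-1}\sum_{i=1}^n\mathbb{I}\{\mathbf{X}_i\le\mathbf{x}\}$ with marginals $F_{np}$, $F_n^-(\mathbf{u})=(F_{n1}^-(u_1),\dots,F_{nd}^-(u_d))$, let $C_n(\mathbf{u})=F_n(F_n^-(\mathbf{u}))$ be the empirical copula, and let $C_n^{\#}(s,\mathbf{u})=n^{-1}\sum_{i=1}^{\lfloor sn\rfloor}\mathbb{I}\{\mathbf{X}_i\le F_n^-(\mathbf{u})\}$. The sequential empirical copula processes are $$\mathbb{C}_n^{\#}(s,\mathbf{u})=\frac1{\sqrt n}\sum_{i=1}^{\lfloor sn\rfloor}\left(\mathbb{I}\{\mathbf{X}_i\le F_n^-(\mathbf{u})\}-C(\mathbf{u})\right),\qquad \mathbb{C}_n^{+}(s,\mathbf{u})=\frac1{\sqrt n}\sum_{i=1}^{\lfloor sn\rfloor}\left(\mathbb{I}\{\mathbf{X}_i\le F_n^-(\mathbf{u})\}-C_n(\mathbf{u})\right).$$ $\mathbb{D}_0=\{\alpha\in C([0,1]^d): \alpha(1,\dots,1)=0$ and $\alpha(\mathbf{x})=0$ if some of the components of $\mathbf{x}$ are equal to $0\}$, and $\mathbb{D}_0^{\#}=\{\alpha\in C([0,1]^{d+1}): \alpha(0,\cdot)=0$ and $\alpha(s,\cdot)\in\mathbb{D}_0$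 for all $s\in(0,1]\}$. The function $\partial_pC$ is defined as $0$ on $\{\mathbf{u}\in[0,1]^d: u_p\in\{0,1\}\}$. The vector $\mathbf{u}^{(p)}=(1,\dots,1,u_p,1,\dots,1)$ is obtained from $\mathbf{u}$ by replacing all entries except the $p$-th by $1$. *)

(* Defs.v *)
From HB Require Import structures.
From mathcomp Require Import all_boot all_order all_algebra.
From mathcomp Require Import all_classical all_reals all_analysis.
From mathcomp Require Import measurable_realfun.

Set Implicit Arguments.
Unset Strict Implicit.
Unset Printing Implicit Defensive.

Import Order.TTheory GRing.Theory Num.Theory.
Import numFieldNormedType.Exports.
Local Open Scope classical_set_scope.
Local Open Scope ring_scope.

(* An element of l^oo(A), A : set T, is represented by a total function on T
   that is bounded on A; the values off A are immaterial, since the topology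
   used is that of [{uniform` A -> R}], which is induced by the pseudometric
   sup_A |f - g|. *)
Definition linfty {R : realType} {T : choiceType} (A : set T) :
    set {uniform` A -> R} :=
  [set f | [bounded (f : T -> R) t | t in A]].
Arguments linfty {R T} A.

(* E^* Z = inf {E U | Z <= U, U measurable, E U exists}.  The integral of a
   function whose positive and negative parts both have infinite integral is a
   junk value in the library, hence the explicit existence condition. *)
Definition outer_expectation {R : realType} d (O : measurableType d)
    (P : probability O R) (Z : O -> R) : \bar R :=
  ereal_inf [set (\int[P]_w U w)%E | U in [set U : O -> \bar R |
    [/\ measurable_fun setT U,
        ((\int[P]_w U^\+ w < +oo) \/ (\int[P]_w U^\- w < +oo))%E &
        forall w, ((Z w)%:E <= U w)%E]]].

Definition outer_probability {R : realType} d (O : measurableType d)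
    (P : probability O R) (E : set O) : \bar R :=
  ereal_inf [set P B | B in [set B | measurable B /\ E `<=` B]].

Definition borel_map {R : realType} {T : choiceType} (A : set T)
    d (O : measurableType d) (B : O -> T -> R) :=
  forall S : set {uniform` A -> R},
    <<s @open {uniform` A -> R} >> S -> measurable (B @^-1` S).

(* Hoffmann-Jorgensen weak convergence: E^* phi(Z_n) --> E phi(B) for every
   bounded continuous phi, with a Borel limit B. *)
Definition weak_cvg_linfty {R : realType} {T : choiceType} (A : set T)
    d (O : measurableType d) (P : probability O R) (Z : nat -> O -> T -> R)
    d' (O' : measurableType d') (P' : probability O' R) (B : O' -> T -> R) :=
  [/\ forall n w, linfty A (Z n w),
      forall w, linfty A (B w),
      borel_map A B &
      forall phi : {uniform` A -> R} -> R,
        {within linfty A, continuous phi} ->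
        [bounded phi f | f in linfty A] ->
        outer_expectation P (fun w => phi (Z n w)) @[n --> \oo] -->
          (\int[P']_w (phi (B w))%:E)%E].

(* Closedness of K is automatic for the Hausdorff space l^oo(A), but not for
   the representation by functions on all of T. *)
Definition tight_map {R : realType} {T : choiceType} (A : set T)
    d (O : measurableType d) (P : probability O R) (B : O -> T -> R) :=
  forall e : R, 0 < e -> exists K : set {uniform` A -> R},
    [/\ compact K, closed K, K `<=` linfty A &
        ((1 - e)%:E <= P (B @^-1` K))%E].

Definition sup_norm {R : realType} {T : choiceType} (A : set T) (f : T -> R) :
    \bar R :=
  ereal_sup [set `|f t|%:E | t in A].

(* sup_A |Z_n| = O_P(a_n), in outer probability *)
Definition unif_bigOP {R : realType} {T : choiceType} (A : set T)
    d (O : measurableType d) (P : probability O R)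
    (Z : nat -> O -> T -> R) (a : nat -> R) :=
  forall e : R, 0 < e -> exists M : R, \forall n \near \oo,
    (outer_probability P [set w | ((M * a n)%:E < sup_norm A (Z n w))%E]
       <= e%:E)%E.

(* [normal_prob m 0] is not the point mass at m, so the degenerate normal law
   is treated separately. *)
Definition gaussian_rv {R : realType} d (O : measurableType d)
    (P : probability O R) (Y : O -> R) :=
  measurable_fun setT Y /\
  exists m s : R, 0 <= s /\
    forall S : set R, measurable S ->
      P (Y @^-1` S) = if s == 0 then \d_m S else normal_prob m s S.

Definition gaussian_field {R : realType} {T : choiceType} (A : set T)
    d (O : measurableType d) (P : probability O R) (B : O -> T -> R) :=
  forall (k : nat) (t : 'I_k -> T) (c : 'I_k -> R), (forall j, A (t j)) ->
    gaussian_rv P (fun w => \sum_(j < k) c j * B w (t j)).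

Definition centered_field {R : realType} {T : choiceType} (A : set T)
    d (O : measurableType d) (P : probability O R) (B : O -> T -> R) :=
  forall t, A t -> ('E_P[fun w => B w t] = 0)%E.

Definition cube (R : realType) (dim : nat) : set 'rV[R]_dim :=
  [set u | forall p, 0 <= u 0 p <= 1].
Arguments cube R dim : clear implicits.

Definition scube (R : realType) (dim : nat) : set (R * 'rV[R]_dim) :=
  [set x | 0 <= x <= 1] `*` cube R dim.
Arguments scube R dim : clear implicits.

Definition D0 (R : realType) (dim : nat) : set ('rV[R]_dim -> R) :=
  [set a | [/\ {within cube R dim, continuous a},
               a (const_mx 1) = 0 &
               forall x, cube R dim x -> (exists p, x 0 p = 0) -> a x = 0]].

Definition D0sharp (R : realType) (dim : nat) : set (R * 'rV[R]_dim -> R) :=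
  [set a | [/\ {within scube R dim, continuous a},
               forall u, cube R dim u -> a (0, u) = 0 &
               forall s, 0 < s <= 1 -> D0 (fun u => a (s, u))]].

Definition strictly_stationary {R : realType} (dim : nat)
    d (O : measurableType d) (P : probability O R)
    (X : int -> O -> dim.-tuple R) :=
  forall (k : nat) (t : 'I_k -> int) (h : int)
      (S : set (k.-tuple (dim.-tuple R))), measurable S ->
    P ((fun w => [tuple X (t j + h) w | j < k]) @^-1` S) =
    P ((fun w => [tuple X (t j) w | j < k]) @^-1` S).

Definition le_vec {R : realType} (dim : nat) (x : dim.-tuple R)
    (u : 'rV[R]_dim) : bool :=
  [forall p, tnth x p <= u 0 p].

Definition joint_cdf {R : realType} (dim : nat) d (O : measurableType d)
    (P : probability O R) (Y : O -> dim.-tuple R) (x : 'rV[R]_dim) : R :=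
  fine (P [set w | le_vec (Y w) x]).

Definition marginal_cdf {R : realType} (dim : nat) d (O : measurableType d)
    (P : probability O R) (Y : O -> dim.-tuple R) (p : 'I_dim) (x : R) : R :=
  fine (P [set w | tnth (Y w) p <= x]).

(* C restricted to the cube is the distribution function of a law with standard
   uniform margins; the values of C off the cube are unconstrained. *)
Definition is_copula {R : realType} (dim : nat) (C : 'rV[R]_dim -> R) :=
  exists mu : probability (dim.-tuple R) R,
    (forall u, cube R dim u ->
       C u = fine (mu [set x : dim.-tuple R | le_vec x u])) /\
    (forall (p : 'I_dim) (S : set R), measurable S ->
       mu ((fun x : dim.-tuple R => tnth x p) @^-1` S)
         = uniform_prob (@ltr01 R) S).

Definition is_copula_of {R : realType} (dim : nat) d (O : measurableType d)
    (P : probability O R) (Y : O -> dim.-tuple R) (C : 'rV[R]_dim -> R) :=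
  is_copula C /\
  forall x : 'rV[R]_dim,
    joint_cdf P Y x = C (\row_p marginal_cdf P Y p (x 0 p)).

Definition inner_slab {R : realType} (dim : nat) (p : 'I_dim) :
    set 'rV[R]_dim :=
  cube R dim `&` [set u | 0 < u 0 p < 1].

Definition partialC {R : realType} (dim : nat) (C : 'rV[R]_dim -> R)
    (p : 'I_dim) (u : 'rV[R]_dim) : R :=
  if 0 < u 0 p < 1 then 'D_(delta_mx 0 p) C u else 0.

Definition smooth_copula {R : realType} (dim : nat) (C : 'rV[R]_dim -> R) :=
  forall p : 'I_dim,
    (forall u, inner_slab p u -> derivable C u (delta_mx 0 p)) /\
    {within inner_slab p, continuous (partialC C p)}.

Definition margin_pt {R : realType} (dim : nat) (p : 'I_dim)
    (u : 'rV[R]_dim) : 'rV[R]_dim :=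
  \row_q (if q == p then u 0 p else 1).

(* The empirical objects below, except [alpha_sharp], are functions of a
   realised sequence x : int -> dim.-tuple R; only the indices 1, ..., n
   matter, and values at n = 0 are junk. *)

(* [Num.truncn] is the floor on nonnegative arguments. *)
Definition sfloor {R : realType} (n : nat) (s : R) : nat :=
  Num.truncn (s * n%:R).

Definition emp_df {R : realType} (dim n : nat) (x : int -> dim.-tuple R)
    (y : 'rV[R]_dim) : R :=
  n%:R^-1 * \sum_(1 <= i < n.+1) (le_vec (x i%:Z) y)%:R.

Definition emp_marginal {R : realType} (dim n : nat)
    (x : int -> dim.-tuple R) (p : 'I_dim) (y : R) : R :=
  n%:R^-1 * \sum_(1 <= i < n.+1) (tnth (x i%:Z) p <= y)%R%:R.

Definition gen_inv {R : realType} (H : R -> R) (q : R) : R :=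
  if q == 0 then sup [set y | H y = 0] else inf [set y | q <= H y].

Definition emp_quantile {R : realType} (dim n : nat)
    (x : int -> dim.-tuple R) (u : 'rV[R]_dim) : 'rV[R]_dim :=
  \row_p gen_inv (emp_marginal n x p) (u 0 p).

Definition emp_copula {R : realType} (dim n : nat)
    (x : int -> dim.-tuple R) (u : 'rV[R]_dim) : R :=
  emp_df n x (emp_quantile n x u).

Definition seq_emp_copula {R : realType} (dim n : nat)
    (x : int -> dim.-tuple R) (t : R * 'rV[R]_dim) : R :=
  n%:R^-1 * \sum_(1 <= i < (sfloor n t.1).+1)
              (le_vec (x i%:Z) (emp_quantile n x t.2))%:R.

Definition Cproc_sharp {R : realType} (dim : nat) (C : 'rV[R]_dim -> R)
    (n : nat) (x : int -> dim.-tuple R) (t : R * 'rV[R]_dim) : R :=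
  (Num.sqrt n%:R)^-1 * \sum_(1 <= i < (sfloor n t.1).+1)
    ((le_vec (x i%:Z) (emp_quantile n x t.2))%:R - C t.2).

Definition Cproc_plus {R : realType} (dim : nat)
    (n : nat) (x : int -> dim.-tuple R) (t : R * 'rV[R]_dim) : R :=
  (Num.sqrt n%:R)^-1 * \sum_(1 <= i < (sfloor n t.1).+1)
    ((le_vec (x i%:Z) (emp_quantile n x t.2))%:R - emp_copula n x t.2).

Definition alpha_sharp {R : realType} (dim : nat) d (O : measurableType d)
    (P : probability O R) (X : int -> O -> dim.-tuple R) (C : 'rV[R]_dim -> R)
    (n : nat) (w : O) (t : R * 'rV[R]_dim) : R :=
  let U (i : int) : dim.-tuple R :=
    [tuple marginal_cdf P (X 0) p (tnth (X i w) p) | p < dim] in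
  (Num.sqrt n%:R)^-1 * \sum_(1 <= i < (sfloor n t.1).+1)
    ((le_vec (U i%:Z) t.2)%:R - C t.2).

(* Main.v *)
Require Import Defs.
From HB Require Import structures.
From mathcomp Require Import all_boot all_order all_algebra.
From mathcomp Require Import all_classical all_reals all_analysis.
From mathcomp Require Import measurable_realfun.
From mathcomp Require Import ring lra.
Set Implicit Arguments.
Unset Strict Implicit.
Unset Printing Implicit Defensive.
Import Order.TTheory GRing.Theory Num.Theory.
Import numFieldNormedType.Exports.
Local Open Scope classical_set_scope.
Local Open Scope ring_scope.

(** The two processes are, up to a negligible error, Lipschitz images of the
    sequential empirical process, and this can be seen realisation by
    realisation.

    Let f be a realisation of the sequential empirical process of the
    U_i = F(X_i), and put v_p(u) = F_p (F_np^- (u_p)).  Almost surely no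
    observation lies in, or at the right end of, an interval on which its
    distribution function is constant ([margin_strict_ae]), and then
    X_i <= F_n^- (u) is the same event as U_i <= v(u).  This turns both
    processes into exact expressions in f ([Cproc_plusE], [Cproc_sharpE]):
      C_n^+ (s, u) = f(s, v) - (floor(sn) / n) f(1, v),
      C_n^# (s, u) = f(s, v) + n^(-1/2) floor(sn) (C(v) - C(u)).
    For the margins, sqrt n (v_p - u_p) = r - f(1, v^(p)), where r is sqrt n
    times the overshoot of the empirical distribution function at its own
    quantile.  The overshoot is at most a jump, so r is at most the modulus of
    continuity of f at any positive distance ([quantile_excess_bound]).  Hence
    v - u is of order n^(-1/2) as long as f stays bounded, and v may be replaced
    by u inside f at the price of a modulus of continuity.  This is part a)
    ([Cproc_plus_approx]).

    For part b) the increment C(v) - C(u) is split into coordinate increments.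
    Away from the faces u_p = 0 and u_p = 1 the mean value theorem and the
    uniform continuity of the p-th partial derivative give
    sqrt n times the increment = - (d_p C)(u) f(1, u^(p)) up to small terms.
    Near these faces the partial derivative may oscillate, but there f(1, u^(p))
    and f(1, v^(p)) are themselves bounded by the modulus of f, since
    f(1, u^(p)) vanishes on the faces, and C is 1-Lipschitz in each coordinate
    ([coordinate_increment], [Cproc_sharp_approx]).

    In both cases the distance to the Lipschitz image of f is at most a constant
    times the modulus of f plus an arbitrarily small number, once n is large and
    f is bounded by a given K.  Weak convergence takes care of the rest
    ([weak_cvg_linfty_approx]): it suffices to test with bounded Lipschitz
    functionals ([weak_cvg_linfty_lip]), and the norm and the modulus of
    continuity are such functionals after truncation, so their outer
    expectations converge to expectations under the limit B, which are small
    because almost every path of B is bounded and uniformly continuous. *)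

(** * Outer expectations *)

Section outer.
Context {R : realType} d (O : measurableType d) (P : probability O R).
Implicit Types Y Z : O -> R.

Lemma integral_cst_prob (r : R) : (\int[P]_w r%:E = r%:E)%E.
Proof.
rewrite integral_cst// -[RHS]mule1; congr (_ * _)%E; exact: probability_setT.
Qed.

Lemma le_outer_expectation Y Z : (forall w, Y w <= Z w) ->
  (outer_expectation P Y <= outer_expectation P Z)%E.
Proof.
move=> YZ; apply: le_ereal_inf => _ [U [mU iU ZU] <-]; exists U => //.
by split => // w; apply: le_trans (ZU w); rewrite lee_fin.
Qed.

(** An almost sure upper bound is enough: the competitor in the infimum is set
    to [+oo] on the exceptional null set, which leaves its integral alone. *)
Lemma outer_expectation_le_integral Z (V : O -> R) :
  P.-integrable setT (EFin \o V) -> {ae P, forall w, Z w <= V w} ->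
  (outer_expectation P Z <= \int[P]_w (V w)%:E)%E.
Proof.
move=> iV [N [mN N0 ZV]].
have mV : measurable_fun setT (EFin \o V) by case/integrableP: iV.
pose U w := if w \in N then +oo%E else (V w)%:E.
have mU : measurable_fun setT U.
  apply: measurable_fun_ifT => //.
  by apply: (measurable_fun_bool true); rewrite setTI preimage_mem_true.
have eU : ae_eq P setT (EFin \o V) U.
  exists N; split => // w /= h; apply: contrapT => wN; apply: h => _.
  by rewrite /U memNset.
apply: ereal_inf_lbound; exists U; last first.
  by apply/esym/ae_eq_integral => //; exact: measurableT.
split => //; last first.
  move=> w; rewrite /U; case: ifPn => [|/negP]; first by rewrite leey.
  rewrite inE => wN; rewrite lee_fin; apply: contrapT => /negP h.
  by apply: wN; apply: ZV => /=; exact/negP.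
left.
have -> : (\int[P]_w U^\+ w = \int[P]_w (EFin \o V)^\+ w)%E.
  apply: ae_eq_integral => //.
  - exact: measurable_funepos.
  - exact: measurable_funepos.
  - by apply: (filterS _ eU) => w /(_ I) h _; rewrite !funeposE h.
have := integrable_funepos measurableT iV.
case/integrableP => _; apply: le_lt_trans; apply: ge0_le_integral => //.
- exact: measurable_funepos.
- by apply: measurableT_comp => //; exact: measurable_funepos.
- by move=> w _; exact: lee_abs.
Qed.

(** For [Y] bounded below, near-optimal competitors can be taken real-valued and
    integrable, and can thus be added. *)
Lemma outer_expectation_lt Y (M a : R) :
  (forall w, - M <= Y w) -> (outer_expectation P Y < a%:E)%E ->
  exists V : O -> R, [/\ P.-integrable setT (EFin \o V),
    {ae P, forall w, Y w <= V w} & (\int[P]_w (V w)%:E < a%:E)%E].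
Proof.
move=> YM /ereal_inf_lt [_ [U [mU _ YU] <-] Ua].
have mUp := measurable_funepos mU.
have mUn := measurable_funeneg mU.
have iUn : (\int[P]_w U^\- w < +oo)%E.
  apply: (@le_lt_trans _ _ (\int[P]_w (Num.max M 0)%:E)%E).
    apply: ge0_le_integral => //.
    move=> w _; rewrite funenegE EFin_max ge_max; apply/andP; split.
      rewrite le_max leeNl -EFinN (le_trans _ (YU w))// lee_fin; exact: YM.
    by rewrite le_max lexx orbT.
  by rewrite integral_cst_prob ltry.
have iU : P.-integrable setT U.
  apply/integrableP; split => //.
  under eq_integral do rewrite (congr1 (@^~ _) (fune_abse U) : `|U _|%E = _).
  rewrite ge0_integralD//.
  have fn : (\int[P]_w U^\- w)%E \is a fin_num.
    by rewrite ge0_fin_numE//; apply: integral_ge0.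
  apply: lte_add_pinfty; last exact: iUn.
  move: Ua; rewrite [X in (X < _)%E -> _]integralE.
  move: fn; case: (\int[P]_w U^\- w)%E => // r _.
  by case: (\int[P]_w U^\+ w)%E => [s||] //; rewrite ltry.
have iV : P.-integrable setT (EFin \o (fine \o U)).
  apply: (le_integrable measurableT _ _ iU).
    by apply/measurable_EFinP; exact: measurableT_comp.
  by move=> w _ /=; case: (U w) => [r||] /=; rewrite ?normr0 ?lexx ?leey.
have eV : ae_eq P setT (EFin \o (fine \o U)) U.
  have := integrable_ae measurableT iU.
  by apply: filterS => w /(_ I) h _ /=; rewrite fineK.
exists (fine \o U); split => //.
  by apply: (filterS _ eV) => w /(_ I) /= h; rewrite -lee_fin h.
have -> // : (\int[P]_w ((fine \o U) w)%:E = \int[P]_w U w)%E.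
apply: ae_eq_integral => //.
by case/integrableP: iV.
Qed.

(** Outer expectations are not additive; monotonicity along almost sure
    inequalities and sublinearity, combined here, take the place of
    linearity. *)
Lemma outer_expectation_le_lin Z Y1 Y2 Y3 (M a1 a2 a3 c2 c3 b : R) :
  (forall w, - M <= Y1 w) -> (forall w, - M <= Y2 w) ->
  (forall w, - M <= Y3 w) -> 0 <= c2 -> 0 <= c3 ->
  (outer_expectation P Y1 < a1%:E)%E -> (outer_expectation P Y2 < a2%:E)%E ->
  (outer_expectation P Y3 < a3%:E)%E ->
  {ae P, forall w, Z w <= Y1 w + c2 * Y2 w + c3 * Y3 w + b} ->
  (outer_expectation P Z <= (a1 + c2 * a2 + c3 * a3 + b)%:E)%E.
Proof.
move=> M1 M2 M3 c20 c30.
move=> /(outer_expectation_lt M1) [V1 [i1 Y1V a1V]].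
move=> /(outer_expectation_lt M2) [V2 [i2 Y2V a2V]].
move=> /(outer_expectation_lt M3) [V3 [i3 Y3V a3V]] ZY.
pose c := (fun=> b%:E) : O -> \bar R.
have ic : P.-integrable setT c.
  exact: finite_measure_integrable_cst.
have i2' := integrableZl measurableT c2 i2.
have i3' := integrableZl measurableT c3 i3.
have i12 := integrableD measurableT i1 i2'.
have i123 := integrableD measurableT i12 i3'.
have i := integrableD measurableT i123 ic.
apply: (@le_trans _ _ (\int[P]_w (V1 w + c2 * V2 w + c3 * V3 w + b)%:E)%E).
  apply: outer_expectation_le_integral; first exact: i.
  apply: (filterS _ (filterI Y1V (filterI Y2V (filterI Y3V ZY)))).
  move=> w [h1 [h2 [h3]]] /le_trans; apply.
  by rewrite lerD2r !lerD// ler_wpM2l.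
have -> : (\int[P]_w (V1 w + c2 * V2 w + c3 * V3 w + b)%:E =
  \int[P]_w (V1 w)%:E + c2%:E * \int[P]_w (V2 w)%:E +
  c3%:E * \int[P]_w (V3 w)%:E + b%:E)%E.
  under eq_integral do rewrite !EFinD !EFinM.
  rewrite (integralD measurableT i123 ic) (integralD measurableT i12 i3').
  rewrite (integralD measurableT i1 i2').
  rewrite (integralZl measurableT i2) (integralZl measurableT i3).
  by rewrite integral_cst_prob.
rewrite !EFinD !EFinM leeD2r// !leeD// ?lee_wpmul2l ?lee_fin//; exact: ltW.
Qed.

End outer.

(** * The sup norm and Lipschitz envelopes of functionals *)

Section linfty.
Context {R : realType} {T : choiceType} (A : set T).
Implicit Types (f g h : T -> R) (psi phi : (T -> R) -> R).

Lemma linftyP f : linfty A f <-> exists M, forall t, A t -> `|f t| <= M.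
Proof.
split=> [[M [_ hM]]|[M hM]].
  by exists (M + 1) => t At; apply: (hM (M + 1)) => //; rewrite ltrDl.
exists M; split; first exact: num_real.
by move=> N MN t At; apply: (le_trans (hM t At)); exact: ltW.
Qed.

Lemma linftyB f g : linfty A f -> linfty A g -> linfty A (fun t => f t - g t).
Proof.
move=> /linftyP[M hM] /linftyP[N hN]; apply/linftyP; exists (M + N) => t At.
by rewrite (le_trans (ler_normB _ _))// lerD ?hM ?hN.
Qed.

(** Meaningful on [linfty A] only: the supremum of an unbounded set is 0. *)
Definition supnorm f : R := sup [set `|f t| | t in A].

Lemma supnorm_le f e : 0 <= e -> (forall t, A t -> `|f t| <= e) ->
  supnorm f <= e.
Proof.
move=> e0 fe; rewrite /supnorm.
have [->|/set0P A0] := eqVneq A set0; first by rewrite image_set0 sup0.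
by apply: ge_sup => [|_ [t At <-]]; [exact: image_nonempty | exact: fe].
Qed.

Lemma le_supnorm f t : linfty A f -> A t -> `|f t| <= supnorm f.
Proof.
move=> /linftyP[M hM] At; apply: ub_le_sup; last by exists t.
by exists M => _ [s As <-]; exact: hM.
Qed.

Lemma supnorm_ge0 f : 0 <= supnorm f.
Proof.
have [h|/sup_out] := pselect (has_sup [set `|f t| | t in A]).
  have [[x xA] _] := h; rewrite (le_trans _ (sup_upper_bound h xA))//.
  by case: xA => t _ <-.
by rewrite /supnorm => ->.
Qed.

Lemma supnormBC f g :
  supnorm (fun t => f t - g t) = supnorm (fun t => g t - f t).
Proof. by congr sup; apply: eq_imagel => t _; rewrite distrC. Qed.

Lemma supnormD f g h : linfty A f -> linfty A g -> linfty A h ->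
  supnorm (fun t => f t - h t) <=
  supnorm (fun t => f t - g t) + supnorm (fun t => g t - h t).
Proof.
move=> lf lg lh; apply: supnorm_le; first by rewrite addr_ge0// supnorm_ge0.
move=> t At; rewrite -(subrKA (g t)) (le_trans (ler_normD _ _))// lerD//.
  by apply: (@le_supnorm (fun t => f t - g t)) => //; exact: linftyB.
by apply: (@le_supnorm (fun t => g t - h t)) => //; exact: linftyB.
Qed.

Definition lip_on (L : R) psi := forall f g, linfty A f -> linfty A g ->
  `|psi f - psi g| <= L * supnorm (fun t => f t - g t).

Lemma near_linfty (f : {uniform` A -> R}) (e : R) : 0 < e ->
  \forall g \near f, forall t, A t -> `|f t - (g : T -> R) t| < e.
Proof.
move=> e0; apply/uniform_nbhs; exists [set xy : R * R | `|xy.1 - xy.2| < e].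
split; last by move=> g.
by apply: (@entourage_ball R R (PosNum e0)).
Qed.

Lemma lip_on_continuous (L : R) psi : lip_on L psi ->
  {within linfty A, continuous (psi : {uniform` A -> R} -> R)}.
Proof.
move=> psiL; apply/subspace_continuousP => f lf.
apply/cvgrPdist_le => e e0; rewrite near_withinE.
have L0 : 0 < `|L| + 1 by rewrite ltr_wpDl.
have eL : 0 < e / (`|L| + 1) by rewrite divr_gt0.
apply: (filterS _ (near_linfty f eL)) => g fg lg.
apply: (le_trans (psiL _ _ lf lg)).
apply: (@le_trans _ _ ((`|L| + 1) * (e / (`|L| + 1)))).
  apply: (le_trans (ler_wpM2r (supnorm_ge0 _) (_ : L <= `|L| + 1))).
  - by rewrite (le_trans (ler_norm _))// lerDl.
  apply: ler_wpM2l; first exact: ltW.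
  apply: supnorm_le => [|t At]; first exact: ltW.
  by apply: ltW; exact: fg.
by rewrite mulrC divfK// gt_eqF.
Qed.

(** The Pasch-Hausdorff envelope from above: an [m]-Lipschitz functional that
    dominates [phi] and approximates it when [m] is large. *)
Definition sup_conv phi (m : R) f : R :=
  sup [set phi g - m * supnorm (fun t => f t - g t) | g in linfty A].

Section sup_conv.
Variables (phi : (T -> R) -> R) (M m : R).
Hypotheses (phiM : forall f, linfty A f -> `|phi f| <= M) (m0 : 0 <= m).

Lemma sup_conv_ubound f g : linfty A g ->
  phi g - m * supnorm (fun t => f t - g t) <= sup_conv phi m f.
Proof.
move=> lg; apply: ub_le_sup; last by exists g.
exists M => _ [h lh <-]; rewrite lerBlDr (le_trans (ler_norm _))//.
by rewrite (le_trans (phiM lh))// lerDl mulr_ge0// supnorm_ge0.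
Qed.

Lemma le_sup_conv f : linfty A f -> phi f <= sup_conv phi m f.
Proof.
move=> lf; apply: (le_trans _ (sup_conv_ubound f lf)).
rewrite (_ : supnorm _ = 0) ?mulr0 ?subr0//.
apply/eqP; rewrite eq_le supnorm_ge0 andbT; apply: supnorm_le => // t At.
by rewrite subrr normr0.
Qed.

Lemma sup_conv_le f b : linfty A f ->
  (forall g, linfty A g -> phi g - m * supnorm (fun t => f t - g t) <= b) ->
  sup_conv phi m f <= b.
Proof.
move=> lf hb; apply: ge_sup => [|_ [g lg <-]]; last exact: hb.
by exists (phi f - m * supnorm (fun t => f t - f t)); exists f.
Qed.

Lemma sup_conv_bounded f : linfty A f -> `|sup_conv phi m f| <= M.
Proof.
move=> lf; rewrite ler_norml; apply/andP; split.
  rewrite (le_trans _ (le_sup_conv lf))//.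
  by have := phiM lf; rewrite ler_norml => /andP[].
apply: sup_conv_le => // g lg; rewrite lerBlDr (le_trans (ler_norm _))//.
by rewrite (le_trans (phiM lg))// lerDl mulr_ge0// supnorm_ge0.
Qed.

Lemma sup_conv_lip : lip_on m (sup_conv phi m).
Proof.
suff H f g : linfty A f -> linfty A g ->
    sup_conv phi m f - sup_conv phi m g <= m * supnorm (fun t => f t - g t).
  move=> f g lf lg; rewrite ler_norml H// andbT lerNl opprB supnormBC.
  exact: H.
move=> lf lg; rewrite lerBlDr; apply: sup_conv_le => // h lh.
rewrite -lerBlDl (le_trans _ (sup_conv_ubound g lh))//.
have := ler_wpM2l m0 (supnormD lg lf lh).
by rewrite mulrDr (supnormBC g f); lra.
Qed.

End sup_conv.

(** Points at distance [d] or more cannot compete in the supremum once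
    [m * d] exceeds the oscillation [2 * M] of [phi]; at smaller distances
    continuity applies. *)
Lemma sup_conv_cvg phi M f : (forall f, linfty A f -> `|phi f| <= M) ->
  {within linfty A, continuous (phi : {uniform` A -> R} -> R)} ->
  linfty A f -> sup_conv phi n%:R f @[n --> \oo] --> phi f.
Proof.
move=> phiM /subspace_continuousP cphi lf; apply/cvgrPdist_le => e e0.
have := cphi f lf; move/cvgrPdist_le => /(_ e e0); rewrite near_withinE.
move/uniform_nbhs => [E []]; rewrite -entourage_from_ballE => -[d d0 dE] hE.
have [N hN] : exists N : nat, forall n, (N <= n)%N -> 2 * M <= n%:R * d.
  exists (Num.truncn (2 * M / d)).+1 => n Nn; rewrite -ler_pdivrMr//.
  rewrite (le_trans (ltW (truncnS_gt _)))// ler_nat//.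
exists N => // n /= Nn; have n0 : 0 <= n%:R :> R by [].
rewrite distrC ger0_norm; last by rewrite subr_ge0; exact: (le_sup_conv phiM).
rewrite lerBlDl; apply: sup_conv_le => // g lg.
have s0 := supnorm_ge0 (fun t => f t - g t).
have [ds|sd] := leP d (supnorm (fun t => f t - g t)).
  have := phiM _ lf; have := phiM _ lg; rewrite !ler_norml => /andP[_ h1] /andP[h2 _].
  have h3 : 2 * M <= n%:R * supnorm (fun t => f t - g t).
    by rewrite (le_trans (hN _ Nn))// ler_wpM2l.
  by lra.
have : `|phi f - phi g| <= e.
  apply: (hE g) => // t At; apply: dE; rewrite /ball /=.
  apply: le_lt_trans sd; apply: (@le_supnorm (fun t => f t - g t)) => //.
  exact: linftyB.
rewrite ler_norml => /andP[h1 _].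
have : 0 <= n%:R * supnorm (fun t => f t - g t) by rewrite mulr_ge0.
by lra.
Qed.

Lemma borel_map_measurable d (O : measurableType d) (B : O -> T -> R) phi :
  (forall w, linfty A (B w)) -> borel_map A B ->
  {within linfty A, continuous (phi : {uniform` A -> R} -> R)} ->
  measurable_fun setT (fun w => phi (B w)).
Proof.
move=> lB bB /continuousP cphi.
apply: (measurability _ (RGenOInfty.measurableE R)).
move=> _ [_ [a ->] <-]; rewrite setTI.
have /open_subspaceP[V oV VE] := cphi _ (@open_gt R a).
rewrite set_itvoy (_ : _ @^-1` _ = B @^-1` V).
  by apply: bB; exact: sub_sigma_algebra.
apply/seteqP; split => w /=.
  move=> h; have : (V `&` linfty A) (B w) by rewrite VE; split => //; exact: lB.
  by case.
move=> h; have : (V `&` linfty A) (B w) by split => //; exact: lB.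
by rewrite VE => -[].
Qed.

End linfty.

(** * Weak convergence and Lipschitz functionals *)

Section portmanteau.
Context {R : realType} {T : choiceType} (A : set T).
Context d (O : measurableType d) (P : probability O R).
Context d' (O' : measurableType d') (P' : probability O' R).

Lemma cvg_ereal_squeezeP (a : nat -> \bar R) (x : R) :
  a n @[n --> \oo] --> x%:E <-> forall e : R, 0 < e ->
    \forall n \near \oo, ((x - e)%:E <= a n <= (x + e)%:E)%E.
Proof.
split=> [/fine_cvgP[fa /cvgrPdist_le ax] e e0|H].
  apply: (filterS2 _ _ fa (ax e e0)) => n /fineK <-.
  by rewrite !lee_fin ler_distlC.
apply/fine_cvgP; split.
  apply: (filterS _ (H 1 ltr01)) => n /andP[h1 h2].
  by rewrite fin_numElt (lt_le_trans (ltNyr _) h1) (le_lt_trans h2 (ltry _)).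
apply/cvgrPdist_le => e /H; apply: filterS => n /=.
case: (a n) => [r||] /andP[]; rewrite ?leye_eq ?leeNy_eq//= !lee_fin.
by move=> h1 h2; rewrite ler_distlC h1 h2.
Qed.

Lemma integral_bounded_cvg (f : nat -> O' -> R) (g : O' -> R) (M : R) :
  (forall n, measurable_fun setT (f n)) -> measurable_fun setT g ->
  (forall n w, `|f n w| <= M) ->
  {ae P', forall w, f n w @[n --> \oo] --> g w} ->
  (\int[P']_w (f n w)%:E)%E @[n --> \oo] --> (\int[P']_w (g w)%:E)%E.
Proof.
move=> mf mg fM fg.
have [|||||] // := @dominated_convergence _ _ R P' setT measurableT
  (fun n w => (f n w)%:E) (fun w => (g w)%:E) (cst M%:E).
- by move=> n; exact/measurable_EFinP.
- exact/measurable_EFinP.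
- apply: (filterS _ fg) => w h _.
  by apply/fine_cvgP; split; [exact: nearW|].
- exact: finite_measure_integrable_cst.
- by apply: nearW => w n _; rewrite lee_fin.
Qed.

Lemma integral_bounded_fin (f : O' -> R) (M : R) :
  measurable_fun setT f -> (forall w, `|f w| <= M) ->
  P'.-integrable setT (EFin \o f).
Proof.
move=> mf fM; apply: measurable_bounded_integrable => //.
  by rewrite -ge0_fin_numE// fin_num_measure.
exists M; split => [|N MN w _]; first exact: num_real.
by apply: (le_trans (fM w)); exact: ltW.
Qed.

(** A bounded continuous functional lies between its Lipschitz envelopes from
    below and from above.  By dominated convergence under the limit law their
    expectations are as close to each other as desired, and the outer
    expectation of the functional is squeezed between those of the
    envelopes. *)
Lemma weak_cvg_linfty_lip (Z : nat -> O -> T -> R) (B : O' -> T -> R) :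
  (forall n w, linfty A (Z n w)) -> (forall w, linfty A (B w)) ->
  borel_map A B ->
  (forall (psi : (T -> R) -> R) (L M : R), 0 <= L -> lip_on A L psi ->
    (forall f, linfty A f -> `|psi f| <= M) ->
    outer_expectation P (fun w => psi (Z n w)) @[n --> \oo] -->
      (\int[P']_w (psi (B w))%:E)%E) ->
  weak_cvg_linfty A P Z P' B.
Proof.
move=> lZ lB bB H; split => // phi cphi [M0 [_ /(_ (M0 + 1))]].
rewrite ltrDl => /(_ ltr01) phiM; set M := M0 + 1 in phiM.
have mphi := borel_map_measurable lB bB cphi.
pose nphi f := - phi f.
have cnphi : {within linfty A, continuous (nphi : {uniform` A -> R} -> R)}.
  by move=> f; apply: cvgN; exact: cphi.
have nphiM f : linfty A f -> `|nphi f| <= M by rewrite normrN; exact: phiM.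
have fin (f : O' -> R) : measurable_fun setT f -> (forall w, `|f w| <= M) ->
    exists r : R, (\int[P']_w (f w)%:E)%E = r%:E.
  move=> mf fM; exists (fine (\int[P']_w (f w)%:E)%E); rewrite fineK//.
  exact: (integrable_fin_num measurableT (integral_bounded_fin mf fM)).
have phiB w : `|phi (B w)| <= M by exact: phiM.
have [x xE] := fin _ mphi phiB; rewrite xE.
pose up n := sup_conv A phi n%:R; pose lo n f := - sup_conv A nphi n%:R f.
have upM n f : linfty A f -> `|up n f| <= M by apply: sup_conv_bounded.
have loM n f : linfty A f -> `|lo n f| <= M.
  by rewrite normrN; apply: sup_conv_bounded.
have upL n : lip_on A n%:R (up n) by apply: (sup_conv_lip phiM).
have loL n : lip_on A n%:R (lo n).
  move=> f g lf lg; rewrite /lo -opprD normrN.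
  exact: (sup_conv_lip nphiM).
have mup n := borel_map_measurable lB bB (lip_on_continuous (upL n)).
have mlo n := borel_map_measurable lB bB (lip_on_continuous (loL n)).
have cup : (\int[P']_w (up n (B w))%:E)%E @[n --> \oo] --> x%:E.
  rewrite -xE; apply: (integral_bounded_cvg (M := M)) => // [n w|].
    exact: upM.
  by apply: nearW => w; apply: (sup_conv_cvg phiM).
have clo : (\int[P']_w (lo n (B w))%:E)%E @[n --> \oo] --> x%:E.
  rewrite -xE; apply: (integral_bounded_cvg (M := M)) => // [n w|].
    exact: loM.
  apply: nearW => w; have := cvgN (sup_conv_cvg nphiM cnphi (lB w)).
  by rewrite opprK => h; exact: h.
apply/cvg_ereal_squeezeP => e e0.
have e20 : 0 < e / 2 by rewrite divr_gt0.
have [N _ /(_ N (leqnn N)) /= hup] := (cvg_ereal_squeezeP _ _).1 cup _ e20.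
have [K _ /(_ K (leqnn K)) /= hlo] := (cvg_ereal_squeezeP _ _).1 clo _ e20.
have [u uE] := fin _ (mup N) (fun w => upM N _ (lB w)).
have [l lE] := fin _ (mlo K) (fun w => loM K _ (lB w)).
rewrite uE !lee_fin in hup; rewrite lE !lee_fin in hlo.
have := H _ _ _ (ler0n _ _) (upL N) (upM N); rewrite uE.
move=> /cvg_ereal_squeezeP/(_ _ e20) Hu.
have := H _ _ _ (ler0n _ _) (loL K) (loM K); rewrite lE.
move=> /cvg_ereal_squeezeP/(_ _ e20) Hl.
apply: filterS2 Hu Hl => n /andP[_ hu] /andP[hl _]; apply/andP; split.
  apply: (le_trans (le_trans _ hl)); first by rewrite lee_fin; lra.
  apply: le_outer_expectation => w; rewrite lerNl.
  by apply: (le_sup_conv nphiM).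
apply: (@le_trans _ _ (outer_expectation P (fun w => up N (Z n w)))).
  by apply: le_outer_expectation => w; apply: (le_sup_conv phiM).
by apply: (le_trans hu); rewrite lee_fin; lra.
Qed.

End portmanteau.

(** * Lipschitz maps and moduli of continuity on the space of bounded functions *)

Section approximation.
Context {R : realType} {T : choiceType} (A : set T).
Implicit Types (f g h : T -> R) (Phi : (T -> R) -> (T -> R)).

Definition linfty_lip (L : R) Phi :=
  (forall f, linfty A f -> linfty A (Phi f)) /\
  forall f g, linfty A f -> linfty A g ->
    supnorm A (fun t => Phi f t - Phi g t) <= L * supnorm A (fun t => f t - g t).

Lemma linfty_lip_continuous (L : R) Phi : linfty_lip L Phi ->
  {within linfty A, continuous (Phi : {uniform` A -> R} -> {uniform` A -> R})}.
Proof.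
move=> [lPhi PhiL]; apply/subspace_continuousP => f lf.
move=> U /uniform_nbhs[E []]; rewrite -entourage_from_ballE => -[e e0 eE] EU.
have L0 : 0 < `|L| + 1 by rewrite ltr_wpDl.
have eL : 0 < e / 2 / (`|L| + 1) by rewrite !divr_gt0.
rewrite /= nbhs_filterE /within /=.
apply: (filterS _ (near_linfty f eL)) => g fg lg; apply: EU => t At; apply: eE.
rewrite /ball /=.
have lPB : linfty A (fun t => Phi f t - Phi g t).
  by apply: linftyB; exact: lPhi.
apply: (le_lt_trans (le_supnorm lPB At)).
apply: (le_lt_trans (PhiL _ _ lf lg)).
apply: (@le_lt_trans _ _ ((`|L| + 1) * (e / 2 / (`|L| + 1)))).
  apply: (le_trans (ler_wpM2r (supnorm_ge0 _ _) (_ : L <= `|L| + 1))).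
    by rewrite (le_trans (ler_norm _))// lerDl.
  apply: ler_wpM2l; first exact: ltW.
  apply: supnorm_le => [|s As]; first exact: ltW.
  by apply: ltW; exact: fg.
by rewrite mulrC divfK ?gt_eqF// ltr_pdivrMr// ltr_pMr// ltr1n.
Qed.

(** The map is continuous on [linfty A] only, not for all functions on [T];
    since the paths stay in [linfty A], preimages of open sets are still
    preimages of open sets. *)
Lemma borel_map_linfty_lip d (O : measurableType d) (B : O -> T -> R)
    (L : R) Phi :
  (forall w, linfty A (B w)) -> borel_map A B -> linfty_lip L Phi ->
  borel_map A (fun w => Phi (B w)).
Proof.
move=> lB bB /linfty_lip_continuous/continuousP cPhi S sS.
pose Q (S : set {uniform` A -> R}) := measurable ((fun w => Phi (B w)) @^-1` S).
suff : <<s @open {uniform` A -> R} >> `<=` Q by apply.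
apply: smallest_sub; first split.
- by rewrite /Q preimage_set0; exact: measurable0.
- by move=> X QX; rewrite /Q setTD preimage_setC; exact: measurableC.
- by move=> F QF; rewrite /Q preimage_bigcup; exact: bigcupT_measurable.
move=> X /cPhi /open_subspaceP[V oV VE].
rewrite /Q (_ : _ @^-1` _ = B @^-1` V).
  by apply: bB; exact: sub_sigma_algebra.
apply/seteqP; split => w /= h.
  have : (V `&` linfty A) (B w) by rewrite VE; split => //; exact: lB.
  by case.
have : (V `&` linfty A) (B w) by split => //; exact: lB.
by rewrite VE => -[].
Qed.

Variable close : R -> T -> T -> Prop.

Definition close_pairs (eta : R) : set (T * T) :=
  [set xy | [/\ A xy.1, A xy.2 & close eta xy.1 xy.2]].

(** The modulus of continuity is itself a uniform norm, taken over pairs of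
    close points. *)
Definition modulus (eta : R) f : R :=
  supnorm (close_pairs eta) (fun xy => f xy.1 - f xy.2).

Lemma linfty_pairs eta f :
  linfty A f -> linfty (close_pairs eta) (fun xy => f xy.1 - f xy.2).
Proof.
move=> /linftyP[M fM]; apply/linftyP; exists (M + M) => -[x y] [/= Ax Ay _].
by rewrite (le_trans (ler_normB _ _))// lerD ?fM.
Qed.

Lemma le_modulus eta f x y : linfty A f -> A x -> A y -> close eta x y ->
  `|f x - f y| <= modulus eta f.
Proof.
move=> lf Ax Ay xy.
by apply: (le_supnorm (t := (x, y)) (linfty_pairs eta lf)); split.
Qed.

Lemma modulus_ge0 eta f : 0 <= modulus eta f.
Proof. exact: supnorm_ge0. Qed.

Lemma modulus_le_supnorm eta f : linfty A f -> modulus eta f <= 2 * supnorm A f.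
Proof.
move=> lf; apply: supnorm_le; first by rewrite mulr_ge0// supnorm_ge0.
move=> -[x y] [/= Ax Ay _]; rewrite (le_trans (ler_normB _ _))//.
by rewrite mulr_natl mulr2n lerD// le_supnorm.
Qed.

Lemma ler_dist_min1 (a b : R) : `|Num.min 1 a - Num.min 1 b| <= `|a - b|.
Proof.
wlog ab : a b / a <= b => [h|].
  by have [/h//|/ltW/h] := leP a b; rewrite distrC (distrC b).
rewrite distrC (distrC a) !ger0_norm ?subr_ge0//; last first.
  by rewrite le_min !ge_min lexx ab orbT.
by rewrite /Num.min; do 2 case: ifPn => //; rewrite -?leNgt => *; lra.
Qed.

Lemma ler_dist_supnorm f g : linfty A f -> linfty A g ->
  `|supnorm A f - supnorm A g| <= supnorm A (fun t => f t - g t).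
Proof.
suff H f' g' : linfty A f' -> linfty A g' ->
    supnorm A f' - supnorm A g' <= supnorm A (fun t => f' t - g' t).
  by move=> lf lg; rewrite ler_norml H// andbT lerNl opprB supnormBC H.
move=> lf lg; rewrite lerBlDr; apply: supnorm_le.
  by rewrite addr_ge0// supnorm_ge0.
move=> t At; rewrite -[f' t](subrK (g' t)) (le_trans (ler_normD _ _))// lerD//.
  by apply: (@le_supnorm _ _ _ (fun t => f' t - g' t)) => //; exact: linftyB.
exact: le_supnorm.
Qed.

(** Truncation makes the modulus a bounded functional. *)
Definition modulus1 eta f : R := Num.min 1 (modulus eta f).

(** A Lipschitz substitute for the indicator that the norm exceeds [K + 1]. *)
Definition excess (K : R) f : R := Num.min 1 (Num.max 0 (supnorm A f - K)).

Lemma min1_bounded (a : R) : 0 <= a -> `|Num.min 1 a| <= 1.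
Proof.
by move=> a0; rewrite ger0_norm ?ge_min ?lexx// le_min a0 ler01.
Qed.

Lemma excess_bounded K f : `|excess K f| <= 1.
Proof. by apply: min1_bounded; rewrite le_max lexx. Qed.

Lemma modulus1_bounded eta f : `|modulus1 eta f| <= 1.
Proof. exact/min1_bounded/modulus_ge0. Qed.

Lemma excess_lip K : lip_on A 1 (excess K).
Proof.
move=> f g lf lg; rewrite mul1r; apply: (le_trans (ler_dist_min1 _ _)).
apply: le_trans (ler_dist_supnorm lf lg).
set a := supnorm A f; set b := supnorm A g.
wlog ab : a b / a <= b => [h|].
  by have [/h//|/ltW/h] := leP a b; rewrite distrC (distrC b).
rewrite distrC (distrC a) !ger0_norm ?subr_ge0//.
  by rewrite /Num.max; do 2 case: ifPn => //; rewrite -?leNgt => *; lra.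
by rewrite ge_max !le_max lexx lerD2r ab orbT.
Qed.

End approximation.

Lemma modulus1_lip {R : realType} {T : choiceType} (A : set T) close (eta : R) :
  lip_on A 2 (modulus1 A close eta).
Proof.
move=> f g lf lg; apply: (le_trans (ler_dist_min1 _ _)).
apply: (le_trans (ler_dist_supnorm (linfty_pairs _ _ lf) (linfty_pairs _ _ lg))).
apply: le_trans (modulus_le_supnorm close eta (linftyB lf lg)).
rewrite /modulus; apply: supnorm_le; first exact: supnorm_ge0.
move=> -[x y] [/= Ax Ay xy]; 
rewrite (_ : _ - _ = (f x - g x) - (f y - g y)); last by ring.
by apply: (le_modulus (linftyB lf lg)).
Qed.

(** * Weak convergence of approximate Lipschitz images *)

Section weak_cvg_approx.
Context {R : realType} {T : choiceType} (A : set T).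
Context d (O : measurableType d) (P : probability O R).
Context d' (O' : measurableType d') (P' : probability O' R).
Variables (Z : nat -> O -> T -> R) (B : O' -> T -> R).
Hypothesis ZB : weak_cvg_linfty A P Z P' B.

Lemma lip_functional_cvg (psi : (T -> R) -> R) (L M : R) :
  lip_on A L psi -> (forall f, linfty A f -> `|psi f| <= M) ->
  outer_expectation P (fun w => psi (Z n w)) @[n --> \oo] -->
    (\int[P']_w (psi (B w))%:E)%E.
Proof.
move=> psiL psiM; case: ZB => _ _ _; apply.
  exact: lip_on_continuous psiL.
exists M; split => [|N MN f lf]; first exact: num_real.
by apply: le_trans (psiM _ lf) _; exact: ltW.
Qed.

(** Portmanteau in the form used for tail events: functionals that tend to 0
    along the limit have small outer expectations, first under the limit and
    then under the converging sequence. *)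
Lemma lip_functional_small (psi : nat -> (T -> R) -> R) (L : R) (e : R) :
  (forall k, lip_on A L (psi k)) -> (forall k f, `|psi k f| <= 1) ->
  {ae P', forall w, psi k (B w) @[k --> \oo] --> 0} -> 0 < e ->
  exists k, \forall n \near \oo,
    (outer_expectation P (fun w => psi k (Z n w)) < e%:E)%E.
Proof.
move=> psiL psi1 psi0 e0; case: ZB => _ lB bB _.
have mpsi k := borel_map_measurable lB bB (lip_on_continuous (psiL k)).
have e20 : 0 < e / 3 by rewrite divr_gt0.
have := integral_bounded_cvg mpsi
  (measurable_cst _ : measurable_fun setT (cst (0 : R) : O' -> R))
  (fun k w => psi1 k (B w)) psi0.
rewrite integral0 => /cvg_ereal_squeezeP/(_ _ e20)[k _ /(_ k (leqnn k)) /= hk].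
exists k; have := lip_functional_cvg (psiL k) (fun f _ => psi1 k f).
have [r rE] : exists r : R, (\int[P']_w (psi k (B w))%:E)%E = r%:E.
  exists (fine (\int[P']_w (psi k (B w))%:E)%E); rewrite fineK//.
  exact: (integrable_fin_num measurableT
    (integral_bounded_fin P' (mpsi k) (fun w => psi1 k (B w)))).
rewrite rE in hk *; move: hk; rewrite !lee_fin => /andP[_ hk].
move=> /cvg_ereal_squeezeP/(_ _ e20); apply: filterS => n /andP[_].
by move=> /le_lt_trans; apply; rewrite lte_fin; lra.
Qed.

Variable close : R -> T -> T -> Prop.
Hypothesis close_le : forall eta eta' x y,
  eta <= eta' -> close eta x y -> close eta' x y.
Hypothesis B_unif_cont : {ae P', forall w, forall e : R, 0 < e ->
  exists2 eta, 0 < eta & forall x y, A x -> A y -> close eta x y ->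
    `|B w x - B w y| <= e}.

(** Asymptotic equicontinuity, deduced from the uniform continuity of the paths
    of the limit. *)
Lemma modulus1_small (e : R) : 0 < e -> exists2 eta, 0 < eta &
  \forall n \near \oo,
    (outer_expectation P (fun w => modulus1 A close eta (Z n w)) < e%:E)%E.
Proof.
move=> e0; suff ae0 :
    {ae P', forall w, modulus1 A close k.+1%:R^-1 (B w) @[k --> \oo] --> 0}.
  have [k hk] := lip_functional_small (fun k => modulus1_lip close k.+1%:R^-1)
    (fun k f => modulus1_bounded A close _ f) ae0 e0.
  by exists k.+1%:R^-1 => //; rewrite invr_gt0.
apply: (filterS _ B_unif_cont) => w uB; apply/cvgrPdist_le => r r0.
  have [eta eta0 hB] := uB r r0.
  exists (Num.truncn eta^-1) => // k /= kk.
  rewrite sub0r normrN ger0_norm; last by rewrite le_min ler01 modulus_ge0.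
  rewrite ge_min; apply/orP; right; apply: supnorm_le; first exact: ltW.
  move=> -[x y] [/= Ax Ay xy]; apply: hB => //; apply: close_le xy.
  rewrite -[leRHS]invrK lef_pV2 ?posrE ?invr_gt0//.
  by rewrite (le_trans (ltW (truncnS_gt _)))// ler_nat.
Qed.

Lemma excess_small (e : R) : 0 < e -> exists K, \forall n \near \oo,
    (outer_expectation P (fun w => excess A K (Z n w)) < e%:E)%E.
Proof.
move=> e0; suff ae0 :
    {ae P', forall w, excess A k%:R (B w) @[k --> \oo] --> (0 : R)}.
  have [k hk] := lip_functional_small (fun k => @excess_lip _ _ A k%:R)
    (fun k f => excess_bounded A _ f) ae0 e0.
  by exists k%:R.
apply: nearW => w; apply: cvg_near_cst.
exists (Num.truncn (supnorm A (B w))).+1 => // k /= kk.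
rewrite /excess max_l ?min_r// subr_le0 (le_trans (ltW (truncnS_gt _)))//.
by rewrite ler_nat.
Qed.

(** An approximate continuous mapping theorem: the error is allowed to involve
    the modulus of continuity of the converging process, and only needs to be
    controlled on bounded sets of paths. *)
Lemma weak_cvg_linfty_approx (Z' : nat -> O -> T -> R)
    (Phi : (T -> R) -> (T -> R)) (L c : R) :
  (forall n w, linfty A (Z' n w)) -> 0 <= L -> 0 <= c ->
  linfty_lip A L Phi ->
  (forall K eta e : R, 0 < eta -> 0 < e -> \forall n \near \oo,
    {ae P, forall w, supnorm A (Z n w) <= K -> forall t, A t ->
      `|Z' n w t - Phi (Z n w) t| <= c * modulus A close eta (Z n w) + e}) ->
  weak_cvg_linfty A P Z' P' (fun w => Phi (B w)).
Proof.
move=> lZ' L0 c0 PhiL happrox; have [lPhi PhiLip] := PhiL.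
have [lZ lB bB _] := ZB.
apply: weak_cvg_linfty_lip => //.
- by move=> w; exact: lPhi.
- exact: borel_map_linfty_lip PhiL.
move=> psi Lp M Lp0 psiL psiM.
have l0 : linfty A (fun=> 0 : R).
  by apply/linftyP; exists 0 => t _; rewrite normr0.
have M0 : 0 <= M by rewrite (le_trans _ (psiM _ l0)).
have psiPhiL : lip_on A (Lp * L) (fun f => psi (Phi f)).
  move=> f g lf lg; apply: (le_trans (psiL _ _ (lPhi _ lf) (lPhi _ lg))).
  by rewrite -mulrA ler_wpM2l// PhiLip.
have psiPhiM f : linfty A f -> `|psi (Phi f)| <= M by move=> /lPhi/psiM.
have := lip_functional_cvg psiPhiL psiPhiM.
have [x ->] : exists x : R, (\int[P']_w (psi (Phi (B w)))%:E)%E = x%:E.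
  exists (fine (\int[P']_w (psi (Phi (B w)))%:E)%E); rewrite fineK//.
  have mf := borel_map_measurable lB bB (lip_on_continuous psiPhiL).
  exact: (integrable_fin_num measurableT
    (integral_bounded_fin P' mf (fun w => psiPhiM _ (lB w)))).
move=> cx; apply/cvg_ereal_squeezeP => e e0.
(* [D] bounds the variation of [psi] per unit of error, and also its total
   oscillation, which is what counts when the norm or the modulus is large *)
pose D := Lp + 2 * M; have D0 : 0 <= D by rewrite addr_ge0// mulr_ge0.
pose dl := e / (4 * (D + 1) * (c + 3)).
have DD : D * (c + 3) * dl <= e / 4.
  rewrite /dl; have -> : D * (c + 3) * (e / (4 * (D + 1) * (c + 3))) =
    e / 4 * (D / (D + 1)) by field; rewrite !gt_eqF// ltr_wpDl.
  apply: ler_piMr; first by rewrite ltW// divr_gt0.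
  by rewrite ler_pdivrMr ?mul1r ?ltr_wpDl// lerDl.
have dl0 : 0 < dl by rewrite divr_gt0// !mulr_gt0// ltr_wpDl.
have [K hK] := excess_small dl0.
have [eta eta0 heta] := modulus1_small dl0.
have e80 : 0 < e / 8 by rewrite divr_gt0.
have key n w : supnorm A (Z n w) <= K + 1 \/ excess A K (Z n w) = 1.
  have [|h] := leP (supnorm A (Z n w)) (K + 1); [by left|right].
  rewrite /excess min_l// le_max; apply/orP; right.
  by rewrite lerBrDl; exact: ltW.
have main n : {ae P, forall w, supnorm A (Z n w) <= K + 1 -> forall t, A t ->
      `|Z' n w t - Phi (Z n w) t| <= c * modulus A close eta (Z n w) + dl} ->
  {ae P, forall w, `|psi (Z' n w) - psi (Phi (Z n w))| <=
    D * excess A K (Z n w) + (D * (c + 1)) * modulus1 A close eta (Z n w)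
    + D * dl}.
  apply: filterS => w hw.
  have m0 : 0 <= modulus1 A close eta (Z n w).
    by rewrite le_min ler01 modulus_ge0.
  have x0 : 0 <= excess A K (Z n w) by rewrite le_min ler01 le_max lexx.
  have triv : `|psi (Z' n w) - psi (Phi (Z n w))| <= 2 * M.
    rewrite (le_trans (ler_normB _ _))// mulr_natl mulr2n lerD ?psiPhiM//.
    by rewrite psiM.
  have MD : 2 * M <= D by rewrite lerDr.
  have [sK|->] := key n w; last first.
    rewrite mulr1; apply: (le_trans triv); apply: (le_trans MD).
    rewrite -addrA lerDl addr_ge0//; last by rewrite mulr_ge0// ltW.
    by rewrite !mulr_ge0// addr_ge0.
  have [m1|m1] := leP 1 (modulus A close eta (Z n w)).
    have -> : modulus1 A close eta (Z n w) = 1 by rewrite /modulus1 min_l.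
    apply: (le_trans triv); apply: (le_trans MD); rewrite mulr1 mulrDr mulr1.
    have := mulr_ge0 D0 x0; have := mulr_ge0 D0 c0; have := mulr_ge0 D0 (ltW dl0).
    by lra.
  have -> : modulus1 A close eta (Z n w) = modulus A close eta (Z n w).
    by rewrite /modulus1 min_r// ltW.
  have m0' := modulus_ge0 A close eta (Z n w).
  have cm0 : 0 <= c * modulus A close eta (Z n w) + dl.
    by apply: addr_ge0; [exact: mulr_ge0 | exact: ltW].
  apply: (@le_trans _ _ (Lp * (c * modulus A close eta (Z n w) + dl))).
    apply: (le_trans (psiL _ _ (lZ' n w) (lPhi _ (lZ n w)))).
    by apply: ler_wpM2l => //; apply: supnorm_le => // t At; exact: hw.
  apply: (@le_trans _ _ (D * (c * modulus A close eta (Z n w) + dl))).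
    by rewrite ler_wpM2r// lerDl mulr_ge0.
  have := mulr_ge0 D0 x0; have := mulr_ge0 D0 m0'.
  by rewrite !mulrDr !mulrDl; nra.
have ha := happrox (K + 1) eta dl eta0 dl0.
have := (cvg_ereal_squeezeP _ _).1 cx _ e80 => hx.
have lowM (a : R) : `|a| <= M -> - (M + 1) <= a.
  by rewrite ler_norml => /andP[h _]; rewrite (le_trans _ h)// lerN2 lerDl.
have low1 (a : R) : `|a| <= 1 -> - (M + 1) <= a.
  by rewrite ler_norml => /andP[h _]; rewrite (le_trans _ h)// lerN2 lerDr.
have c10 : 0 <= D * (c + 1) by rewrite mulr_ge0// addr_ge0.

apply: (filterS3 _ _ hK heta (filterI ha hx)).
move=> n hKn hetan [/main han /andP[hx1 hx2]].
have lin (Y Y' : O -> R) (a : R) : (forall w, `|Y w| <= M) ->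
    (outer_expectation P Y < a%:E)%E ->
    {ae P, forall w, Y' w <= Y w + (D * excess A K (Z n w) +
      (D * (c + 1)) * modulus1 A close eta (Z n w) + D * dl)} ->
    (outer_expectation P Y' <= (a + D * dl + D * (c + 1) * dl + D * dl)%:E)%E.
  move=> YM Ya YY'; apply: (outer_expectation_le_lin (M := M + 1) _ _ _ _ _
    Ya hKn hetan) => //.
  - by move=> w; exact/lowM/YM.
  - by move=> w; exact/low1/excess_bounded.
  - by move=> w; exact/low1/modulus1_bounded.
  - by apply: (filterS _ YY') => w; rewrite !addrA.
apply/andP; split.
- rewrite leNgt; apply/negP => hlt.
  have han' : {ae P, forall w, psi (Phi (Z n w)) <= psi (Z' n w) +
      (D * excess A K (Z n w) + (D * (c + 1)) * modulus1 A close eta (Z n w)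
       + D * dl)}.
    by apply: (filterS _ han) => w; rewrite ler_distlC => /andP[_].
  have := le_trans hx1 (lin _ _ _ (fun w => psiM _ (lZ' n w)) hlt han').
  by rewrite lee_fin; rewrite mulrDr !mulrDl in DD *; lra.
- apply: (@le_trans _ _ (x + e / 4 + D * dl + D * (c + 1) * dl + D * dl)%:E).
    apply: (lin (fun w => psi (Phi (Z n w)))).
    + by move=> w; exact: psiPhiM.
    + by apply: (le_lt_trans hx2); rewrite lte_fin; lra.
    by apply: (filterS _ han) => w; rewrite ler_distl => /andP[_].
  by rewrite lee_fin; rewrite mulrDr !mulrDl in DD *; lra.
Qed.

End weak_cvg_approx.

(** * Quantiles and the empirical processes in terms of the probability transforms *)

Definition close {R : realType} (dim : nat) (eta : R)
    (t t' : R * 'rV[R]_dim) : Prop :=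
  `|t.1 - t'.1| <= eta /\ forall p, `|t.2 0 p - t'.2 0 p| <= eta.

Lemma sum_sub_const {R : pzRingType} (k : nat) (a : nat -> R) (c : R) :
  \sum_(1 <= i < k.+1) (a i - c) = \sum_(1 <= i < k.+1) a i - k%:R * c.
Proof. by rewrite sumrB sumr_const_nat subn1 mulr_natl. Qed.

Lemma sfloor1 {R : realType} n : sfloor n (1 : R) = n.
Proof. by rewrite /sfloor mul1r natrK. Qed.

Lemma sfloor_le {R : realType} n (s : R) : 0 <= s <= 1 ->
  (sfloor n s)%:R <= s * n%:R.
Proof. by move=> /andP[s0 _]; rewrite truncn_le// mulr_ge0. Qed.

Lemma sfloor_gt {R : realType} n (s : R) : s * n%:R < (sfloor n s)%:R + 1.
Proof. by rewrite natr1 truncnS_gt. Qed.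

Lemma sfloor_leq {R : realType} n (s : R) : 0 <= s <= 1 -> (sfloor n s <= n)%N.
Proof.
move=> s01; rewrite -(ler_nat R) (le_trans (sfloor_le n s01))//.
by rewrite ler_piMl//; case/andP: s01.
Qed.

Section empirical_quantile.
Context {R : realType} (n : nat) (a : nat -> R).

Let H (y : R) : R := n%:R^-1 * \sum_(1 <= i < n.+1) (a i <= y)%R%:R.

Lemma emp_nondecreasing : {homo H : y z / y <= z}.
Proof.
move=> y z yz; rewrite /H ler_wpM2l ?invr_ge0//; apply: ler_sum => i _.
rewrite ler_nat; case: (leP (a i) y) => // ay.
by rewrite (le_trans ay yz).
Qed.

Lemma emp_ge0 y : 0 <= H y.
Proof. by rewrite mulr_ge0 ?invr_ge0// sumr_ge0. Qed.

Lemma emp_bounds : exists lo hi : R,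
  forall i, (1 <= i <= n)%N -> lo < a i <= hi.
Proof.
elim: n => [|k [lo [hi h]]]; first by exists 0, 0 => -[].
exists (Num.min lo (a k.+1 - 1)), (Num.max hi (a k.+1)) => i /andP[i1].
rewrite leq_eqVlt ltnS => /orP[/eqP ->|ik].
  by rewrite le_max lexx orbT gt_min ltrBlDr ltrDl ltr01 orbT.
have /andP[h1 h2] := h i (introT andP (conj i1 ik)).
by rewrite gt_min h1 le_max h2.
Qed.

(** An empirical distribution function is constant just to the right of each
    point; this gives the attainment of the infimum in the quantile. *)
Lemma emp_right_gap y : exists2 m : R, y < m &
  forall i, (1 <= i <= n)%N -> a i <= y \/ m <= a i.
Proof.
elim: n => [|k [m ym h]]; first by exists (y + 1) => [|[]//]; rewrite ltrDl.
have [ay|ya] := leP (a k.+1) y.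
  exists m => // i /andP[i1]; rewrite leq_eqVlt ltnS => /orP[/eqP ->|ik].
    by left.
  by apply: h; rewrite i1.
exists (Num.min m (a k.+1)) => [|i /andP[i1]]; first by rewrite lt_min ym.
rewrite leq_eqVlt ltnS => /orP[/eqP ->|ik].
  by right; rewrite ge_min lexx orbT.
by have [|aiy|mi] := h i; [rewrite i1|left|right; rewrite ge_min mi].
Qed.

(** The two inequalities say that [gen_inv] returns a quantile, the convention
    at level 0 included. *)
Lemma gen_inv_emp q : (0 < n)%N -> 0 <= q <= 1 ->
  q <= H (gen_inv H q) /\ forall y, y < gen_inv H q -> H y <= q.
Proof.
move=> n0 /andP[q0 q1]; have [lo [hi lohi]] := emp_bounds.
have Hlo y : y <= lo -> H y = 0.
  move=> ylo; rewrite /H big_nat_cond big1 ?mulr0// => i; rewrite andbT ltnS.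
  move=> /lohi/andP[loi _]; case: leP => // /(lt_le_trans loi).
  by rewrite ltNge ylo.
have Hhi y : hi <= y -> H y = 1.
  move=> hiy; rewrite /H (eq_big_nat _ _ (F2 := fun=> 1)) => [|i]; last first.
    by rewrite ltnS => /lohi/andP[_ /le_trans->].
  by rewrite sumr_const_nat subn1 mulVf// pnatr_eq0 -lt0n.
rewrite /gen_inv; case: eqP => [->|/eqP qn0]; split; first exact: emp_ge0.
- move=> y ysup; have hs : has_sup [set y | H y = 0].
    split; first by exists lo; exact: Hlo.
    exists hi => z /= Hz; rewrite leNgt; apply/negP => /ltW /Hhi.
    by rewrite Hz => /esym/eqP; rewrite oner_eq0.
  have := sup_adherent (_ : 0 < sup [set y | H y = 0] - y) hs.
  rewrite subr_gt0 ysup => /(_ isT)[z /= Hz]; rewrite subKr => yz.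
  by rewrite -Hz; apply: emp_nondecreasing; exact: ltW.
- have hi' : has_inf [set y | q <= H y].
    split; first by exists hi => /=; rewrite Hhi.
    exists lo => z /= qz; rewrite leNgt; apply/negP => /ltW /Hlo Hz.
    by move: qz; rewrite Hz leNgt lt_neqAle eq_sym qn0 q0.
  have [m ym hm] := emp_right_gap (inf [set y | q <= H y]).
  set y0 := inf _ in ym hm *.
  have := inf_adherent (_ : 0 < m - y0) hi'.
  rewrite subr_gt0 ym => /(_ isT)[z /= qz]; rewrite addrC subrK => zm.
  apply: (le_trans qz); rewrite /H ler_wpM2l ?invr_ge0//.
  rewrite big_nat_cond [leRHS]big_nat_cond; apply: ler_sum => i.
  rewrite andbT ltnS => /hm[->|mi]; first by rewrite lern1 leq_b1.
  have -> : (a i <= z) = false.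
    by apply/negbTE; rewrite -ltNge (lt_le_trans zm mi).
  by rewrite ler0n.
- move=> y yinf; rewrite leNgt; apply/negP => /ltW qy.
  move: yinf; rewrite ltNge => /negP; apply; apply: ge_inf => //.
  exists lo => z /= qz; rewrite leNgt; apply/negP => /ltW /Hlo Hz.
  by move: qz; rewrite Hz leNgt lt_neqAle eq_sym qn0 q0.
Qed.

End empirical_quantile.

Section empirical_identities.
Context {R : realType} (dim : nat) (C : 'rV[R]_dim -> R).
Variables (F : 'I_dim -> R -> R) (x : int -> dim.-tuple R).
Hypotheses (Fmono : forall p, {homo F p : y z / y <= z})
  (F01 : forall p y, 0 <= F p y <= 1) (Fcont : forall p, continuous (F p))
  (Fx : forall (i : nat) p y, y < tnth (x i%:Z) p -> F p y < F p (tnth (x i%:Z) p))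
  (Cmargin : forall p u, cube R dim u -> C (margin_pt p u) = u 0 p).

Definition prob_transform (i : int) : dim.-tuple R :=
  [tuple F p (tnth (x i) p) | p < dim].

(** Coincides with [alpha_sharp] when [F] consists of the margins of the first
    observation; the randomness enters through [x] only. *)
Definition alpha n (t : R * 'rV[R]_dim) : R :=
  (Num.sqrt n%:R)^-1 * \sum_(1 <= i < (sfloor n t.1).+1)
    ((le_vec (prob_transform i%:Z) t.2)%:R - C t.2).

Definition quantile_transform n (u : 'rV[R]_dim) : 'rV[R]_dim :=
  \row_p F p (emp_quantile n x u 0 p).

Local Notation v := quantile_transform.

(** Strict growth of [F] up to each observation is what makes the probability
    transform reflect the order. *)
Lemma le_prob_transform (i : nat) p y :
  (F p (tnth (x i%:Z) p) <= F p y) = (tnth (x i%:Z) p <= y).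
Proof.
by apply/idP/idP => [|/Fmono//]; apply: contraTT; rewrite -!ltNge => /Fx.
Qed.

Lemma le_vec_prob_transform n (i : nat) u :
  le_vec (x i%:Z) (emp_quantile n x u) = le_vec (prob_transform i%:Z) (v n u).
Proof.
by apply: eq_forallb => p; rewrite tnth_mktuple [v n u 0 p]mxE le_prob_transform.
Qed.

Lemma quantile_transform_cube n u : cube R dim (v n u).
Proof. by move=> p; rewrite mxE F01. Qed.

Lemma emp_copulaE n u :
  emp_copula n x u = n%:R^-1 *
    \sum_(1 <= i < n.+1) (le_vec (prob_transform i%:Z) (v n u))%:R.
Proof. by congr (_ * _); apply: eq_bigr => i _; rewrite le_vec_prob_transform. Qed.

Lemma natr_sqrt_neq0 n : (0 < n)%N ->
  (n%:R != 0 :> R) * (Num.sqrt n%:R != 0 :> R).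
Proof. by move=> n0; rewrite pnatr_eq0 sqrtr_eq0 -ltNge ltr0n -lt0n. Qed.

Lemma Cproc_plusE n s u : (0 < n)%N ->
  Cproc_plus n x (s, u) =
  alpha n (s, v n u) - (sfloor n s)%:R / n%:R * alpha n (1, v n u).
Proof.
move=> n0; rewrite /Cproc_plus /alpha /= sfloor1 !sum_sub_const emp_copulaE.
under eq_bigr do rewrite le_vec_prob_transform.
by field; rewrite !natr_sqrt_neq0.
Qed.

Lemma Cproc_sharpE n s u :
  Cproc_sharp C n x (s, u) = alpha n (s, v n u) +
    (Num.sqrt n%:R)^-1 * ((sfloor n s)%:R * (C (v n u) - C u)).
Proof.
rewrite /Cproc_sharp /alpha /= !sum_sub_const.
by under eq_bigr do rewrite le_vec_prob_transform; ring.
Qed.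

Lemma margin_pt_cube p u : cube R dim u -> cube R dim (margin_pt p u).
Proof. by move=> cu q; rewrite mxE; case: ifP => // _; rewrite ler01 lexx. Qed.

Lemma margin_pt_close (eta : R) p (u u' : 'rV[R]_dim) : 0 <= eta ->
  `|u 0 p - u' 0 p| <= eta -> close eta (1, margin_pt p u) (1, margin_pt p u').
Proof.
move=> eta0 h; split=> [|q]; rewrite /= ?subrr ?normr0// !mxE.
by case: ifP => // _; rewrite subrr normr0.
Qed.

Lemma le_vec_margin (i : int) p u :
  le_vec (prob_transform i) (margin_pt p u) = (F p (tnth (x i) p) <= u 0 p).
Proof.
apply/forallP/idP => [/(_ p)|h q]; rewrite tnth_mktuple mxE ?eqxx//.
by case: eqP => [->//|_]; case/andP: (F01 q (tnth (x i) q)).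
Qed.

Lemma alpha_margin n p u : cube R dim u ->
  alpha n (1, margin_pt p u) = (Num.sqrt n%:R)^-1 *
    (\sum_(1 <= i < n.+1) (F p (tnth (x i%:Z) p) <= u 0 p)%R%:R - n%:R * u 0 p).
Proof.
move=> cu; rewrite /alpha /= sfloor1 sum_sub_const Cmargin//.
by congr (_ * (_ - _)); apply: eq_bigr => i _; rewrite le_vec_margin.
Qed.

(** At level 0 this uses that no transformed observation is 0, a consequence
    of the strict growth of [F] below it; at level 1 the sum and its centering are both
    [n]. *)
Lemma alpha_margin_boundary n p u : cube R dim u -> u 0 p = 0 \/ u 0 p = 1 ->
  alpha n (1, margin_pt p u) = 0.
Proof.
move=> cu u01; rewrite alpha_margin//; case: u01 => ->.
  rewrite big1 ?mulr0 ?subr0 ?mulr0// => i _; case: leP => //.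
  have := @Fx i p (tnth (x i%:Z) p - 1); rewrite ltrBlDr ltrDl ltr01 => /(_ isT).
  by case/andP: (F01 p (tnth (x i%:Z) p - 1)) => h _ /(le_lt_trans h); case: leP.
rewrite (eq_bigr (fun=> 1)) => [|i _]; last first.
  by case/andP: (F01 p (tnth (x i%:Z) p)) => _ ->.
by rewrite sumr_const_nat subn1 mulr1 subrr mulr0.
Qed.

Definition quantile_excess n p (u : 'rV[R]_dim) : R :=
  Num.sqrt n%:R * (emp_marginal n x p (emp_quantile n x u 0 p) - u 0 p).

Lemma sqrt_natrM n : (0 < n)%N -> (Num.sqrt n%:R)^-1 * n%:R = Num.sqrt n%:R :> R.
Proof.
move=> n0; rewrite -[X in _ * X](@sqr_sqrtr _ n%:R)// expr2 mulrA mulVf ?mul1r//.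
exact: (natr_sqrt_neq0 n0).2.
Qed.

Lemma emp_marginalE n p y : (0 < n)%N ->
  emp_marginal n x p y =
  n%:R^-1 * \sum_(1 <= i < n.+1) (F p (tnth (x i%:Z) p) <= F p y)%R%:R.
Proof.
by move=> n0; congr (_ * _); apply: eq_bigr => i _; rewrite le_prob_transform.
Qed.

(** The empirical distribution function at the empirical quantile can be read
    off [alpha] at [v], and is also close to [u]; comparing the two gives the
    deviation of [v] from [u]. *)
Lemma quantile_transform_sub n p u : (0 < n)%N -> cube R dim u ->
  Num.sqrt n%:R * (v n u 0 p - u 0 p) =
  quantile_excess n p u - alpha n (1, margin_pt p (v n u)).
Proof.
move=> n0 cu; rewrite alpha_margin; last exact: quantile_transform_cube.
rewrite /quantile_excess emp_marginalE// [v n u 0 p]mxE.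
rewrite (_ : (Num.sqrt n%:R)^-1 = Num.sqrt n%:R / n%:R); last first.
  by rewrite -[in RHS](sqrt_natrM n0); field; rewrite !natr_sqrt_neq0.
by field; rewrite natr_sqrt_neq0.
Qed.

(** The overshoot of the empirical distribution function at its own quantile is
    one of its jumps, hence an oscillation of [alpha] over an arbitrarily short
    distance.  Under dependence several observations may coincide, so the size
    of a jump cannot be bounded by counting. *)
Lemma quantile_excess_bound n p u (eta W : R) : (0 < n)%N -> 0 < eta ->
  cube R dim u ->
  (forall t t', scube R dim t -> scube R dim t' -> close eta t t' ->
    `|alpha n t - alpha n t'| <= W) ->
  0 <= quantile_excess n p u <= W.
Proof.
move=> n0 eta0 cu aW; set y : R := emp_quantile n x u 0 p.
have sn0 : 0 < Num.sqrt n%:R :> R by rewrite sqrtr_gt0 ltr0n.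
have [h1 h2] := gen_inv_emp (fun i => tnth (x i%:Z) p) n0 (cu p).
have {}h1 : u 0 p <= emp_marginal n x p y by rewrite /y mxE.
have {}h2 z : z < y -> emp_marginal n x p z <= u 0 p by rewrite /y mxE; exact: h2.
rewrite /quantile_excess -/y; apply/andP; split.
  by apply: mulr_ge0; rewrite ?subr_ge0//; exact: ltW.
apply/ler_addgt0Pr => e e0.
have /cvgrPdist_le/(_ (Num.min eta (e / Num.sqrt n%:R))) := @Fcont p y.
rewrite lt_min eta0 divr_gt0// => /(_ isT)/nbhs_ballP[dl /= dl0 hdl].
pose z := y - dl / 2.
have zy : z < y by rewrite /z ltrBlDr ltrDl divr_gt0.
have /hdl : ball y dl z.
  rewrite /ball /= /z subKr gtr0_norm ?divr_gt0//.
  by rewrite ltr_pdivrMr// ltr_pMr// ltr1n.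
have Fyz : F p z <= F p y by apply: Fmono; exact: ltW.
rewrite ger0_norm ?subr_ge0// le_min => /andP[Feta Fe].
pose w (y : R) : 'rV[R]_dim := \row_q F q y.
have cw y' : cube R dim (w y') by move=> q; rewrite mxE F01.
have sw y' : scube R dim (1, margin_pt p (w y')).
  by split; [rewrite /= ler01 lexx | exact: margin_pt_cube].
have aE y' : alpha n (1, margin_pt p (w y')) =
    Num.sqrt n%:R * (emp_marginal n x p y' - F p y').
  rewrite alpha_margin// emp_marginalE// mxE -[in RHS](sqrt_natrM n0).
  by field; rewrite !natr_sqrt_neq0.
have := aW _ _ (sw y) (sw z); rewrite !aE => /(_ _)/(le_trans (ler_norm _)) H.
have {}H := H (margin_pt_close (ltW eta0) _).
have {}H : Num.sqrt n%:R * (emp_marginal n x p y - F p y) -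
   Num.sqrt n%:R * (emp_marginal n x p z - F p z) <= W.
  by apply: H; rewrite !mxE ger0_norm// subr_ge0.
have h3 := h2 _ zy.
have : Num.sqrt n%:R * emp_marginal n x p z <= Num.sqrt n%:R * u 0 p.
  by rewrite ler_wpM2l// ltW.
have : Num.sqrt n%:R * (F p y - F p z) <= e.
  by rewrite mulrC -ler_pdivlMr.
by lra.
Qed.

End empirical_identities.

(** * Approximation of the empirical copula processes, path by path *)

Section deterministic_bounds.
Context {R : realType} (dim : nat) (C : 'rV[R]_dim -> R).
Variables (F : 'I_dim -> R -> R) (x : int -> dim.-tuple R).
Hypotheses (Fmono : forall p, {homo F p : y z / y <= z})
  (F01 : forall p y, 0 <= F p y <= 1) (Fcont : forall p, continuous (F p))
  (Fx : forall (i : nat) p y, y < tnth (x i%:Z) p -> F p y < F p (tnth (x i%:Z) p))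
  (Cmargin : forall p u, cube R dim u -> C (margin_pt p u) = u 0 p).
Variables (n : nat) (eta K : R).
Hypotheses (n0 : (0 < n)%N) (eta0 : 0 < eta).

Let f := alpha C F x n.
Local Notation v := (quantile_transform F x n).
Let W := modulus (scube R dim) (@close R dim) eta f.

Hypotheses (lf : linfty (scube R dim) f) (fK : supnorm (scube R dim) f <= K).

Let sn0 : 0 < Num.sqrt n%:R :> R. Proof. by rewrite sqrtr_gt0 ltr0n. Qed.

Let K0 : 0 <= K. Proof. exact: le_trans (supnorm_ge0 _ _) fK. Qed.

Let W0 : 0 <= W. Proof. exact: modulus_ge0. Qed.

Let fW t t' : scube R dim t -> scube R dim t' -> close eta t t' ->
  `|f t - f t'| <= W.
Proof. by move=> ct ct'; exact: le_modulus. Qed.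

Let fle t : scube R dim t -> `|f t| <= K.
Proof. by move=> ct; apply: le_trans fK; exact: le_supnorm. Qed.

Let scube1 (u : 'rV[R]_dim) : cube R dim u -> scube R dim (1, u).
Proof. by move=> cu; split => //=; rewrite ler01 lexx. Qed.

Let vcube u : cube R dim (v u). Proof. exact: quantile_transform_cube. Qed.

Let excessW p u : cube R dim u -> `|quantile_excess x n p u| <= W.
Proof.
move=> cu; have /andP[h1 h2] : 0 <= quantile_excess x n p u <= W.
  exact: (quantile_excess_bound Fmono F01 Fcont Fx Cmargin p n0 eta0 cu fW).
by rewrite ger0_norm.
Qed.

Let shift p u : cube R dim u -> Num.sqrt n%:R * (v u 0 p - u 0 p) =
  quantile_excess x n p u - f (1, margin_pt p (v u)).
Proof. exact: quantile_transform_sub. Qed.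

Lemma quantile_transform_shift p u : cube R dim u ->
  Num.sqrt n%:R * `|v u 0 p - u 0 p| <= 3 * K.
Proof.
move=> cu; rewrite -[X in X * _](gtr0_norm sn0) -normrM shift//.
rewrite (le_trans (ler_normB _ _))//.
have := excessW p cu; have := modulus_le_supnorm (@close R dim) eta lf.
have : `|f (1, margin_pt p (v u))| <= K.
  by apply: fle; apply/scube1/margin_pt_cube.
by rewrite -/W; move: fK; lra.
Qed.

Lemma quantile_transform_near p u r : cube R dim u ->
  3 * K <= r * Num.sqrt n%:R -> `|v u 0 p - u 0 p| <= r.
Proof.
move=> cu Kr; rewrite -(ler_pM2l sn0) (le_trans (quantile_transform_shift p cu))//.
by rewrite [leRHS]mulrC.
Qed.

Let lam (s : R) : R := (sfloor n s)%:R / n%:R.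

Let lam01 s : 0 <= s <= 1 -> 0 <= lam s <= 1.
Proof.
move=> s01; rewrite divr_ge0//= ler_pdivrMr ?ltr0n// mul1r ler_nat.
exact: sfloor_leq.
Qed.

Let lamB s : 0 <= s <= 1 -> `|s - lam s| <= n%:R^-1.
Proof.
move=> s01; have nn : 0 < n%:R :> R by rewrite ltr0n.
rewrite ger0_norm; last by rewrite subr_ge0 ler_pdivrMr// sfloor_le.
rewrite -(ler_pM2r nn) mulrBl mulVf ?gt_eqF// divfK ?gt_eqF//.
by rewrite lerBlDl ltW// sfloor_gt.
Qed.

(** The process is the image of [f] with [v] in place of [u] and [floor (s n) / n]
    in place of [s]; undoing the first replacement costs two moduli, undoing the
    second at most the norm over [n]. *)
Lemma Cproc_plus_approx t : scube R dim t -> 3 * K <= eta * Num.sqrt n%:R ->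
  `|Cproc_plus n x t - (f t - t.1 * f (1, t.2))| <= 2 * W + K / n%:R.
Proof.
case: t => s u [/= s01 cu] Keta.
have uv r : close eta (r, v u) (r, u).
  split=> [|p]; first by rewrite subrr normr0 ltW.
  exact: quantile_transform_near.
rewrite (Cproc_plusE C Fmono Fx)// -/f -/(lam s).
rewrite (_ : _ - _ = (f (s, v u) - f (s, u)) - lam s * (f (1, v u) - f (1, u))
   + (s - lam s) * f (1, u)); last by ring.
have h1 : `|f (s, v u) - f (s, u)| <= W.
  by apply: fW; [split => //; exact: vcube | by [] | exact: uv].
have h2 : `|lam s * (f (1, v u) - f (1, u))| <= W.
  rewrite normrM -[leRHS]mul1r; have /andP[l0 l1] := lam01 s01.
  apply: ler_pM => //; first by rewrite ger0_norm.
  by apply: fW => //; apply: scube1 => //; exact: vcube.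
have h3 : `|(s - lam s) * f (1, u)| <= K / n%:R.
  by rewrite normrM mulrC ler_pM// ?lamB// fle//; exact: scube1.
rewrite (le_trans (ler_normD _ _))// (le_trans (lerD (ler_normB _ _) h3))//.
by lra.
Qed.

Section smooth.
Hypothesis Clip : forall p u u', cube R dim u -> cube R dim u' ->
  (forall q, q != p -> u 0 q = u' 0 q) -> `|C u - C u'| <= `|u 0 p - u' 0 p|.
Hypothesis dC1 : forall p u, cube R dim u -> `|partialC C p u| <= 1.
Hypothesis dCmvt : forall p u u', cube R dim u -> cube R dim u' ->
  (forall q, q != p -> u 0 q = u' 0 q) -> 0 < u 0 p < 1 -> 0 < u' 0 p < 1 ->
  exists xi, [/\ cube R dim xi, forall q, q != p -> xi 0 q = u 0 q,
    Num.min (u 0 p) (u' 0 p) <= xi 0 p <= Num.max (u 0 p) (u' 0 p) &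
    C u' - C u = partialC C p xi * (u' 0 p - u 0 p)].
Variables (e dl : R).
Hypotheses (e0 : 0 <= e) (dl0 : 0 < dl) (dleta : dl <= eta / 4).
Hypothesis dCunif : forall p u u', cube R dim u -> cube R dim u' ->
  eta / 4 <= u 0 p <= 1 - eta / 4 -> eta / 4 <= u' 0 p <= 1 - eta / 4 ->
  (forall q, `|u 0 q - u' 0 q| <= dl) ->
  `|partialC C p u - partialC C p u'| <= e.
Hypothesis Kdl : 3 * K <= dl * Num.sqrt n%:R.

Let vdl p u : cube R dim u -> `|v u 0 p - u 0 p| <= dl.
Proof. by move=> cu; exact: quantile_transform_near. Qed.

(** Close to the faces the margins of [alpha] are small because they vanish on
    the faces. *)
Lemma margin_near_boundary p u (b : R) : cube R dim u ->
  b = 0 \/ b = 1 -> `|u 0 p - b| <= eta -> `|f (1, margin_pt p u)| <= W.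
Proof.
move=> cu b01 ub.
have cb : cube R dim (const_mx b).
  by move=> q; rewrite mxE; case: b01 => ->; rewrite !lexx ler01.
have fb : f (1, margin_pt p (const_mx b)) = 0.
  by apply: (alpha_margin_boundary F01 Fx Cmargin) => //; rewrite mxE.
rewrite -[f _]subr0 -fb; apply: fW.
- exact/scube1/margin_pt_cube.
- exact/scube1/margin_pt_cube.
- by apply: margin_pt_close; [exact: ltW | rewrite mxE].
Qed.

(** One step of the expansion of [C (v u) - C u], from [a] to [b], which differ
    in the coordinate [p] only.  If [u 0 p] is within [eta / 2] of 0 or 1, all
    terms are small separately; otherwise the segment from [a] to [b] stays in
    the slab where the partial derivative is uniformly continuous. *)
Lemma coordinate_increment p u a b : cube R dim u -> cube R dim a ->
  cube R dim b -> (forall q, q != p -> a 0 q = b 0 q) ->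
  a 0 p = u 0 p -> b 0 p = v u 0 p -> (forall q, `|a 0 q - u 0 q| <= dl) ->
  `|Num.sqrt n%:R * (C b - C a) + partialC C p u * f (1, margin_pt p u)|
     <= 3 * W + 3 * K * e.
Proof.
move=> cu ca cb ab au bv adl.
have sKe : 0 <= 3 * K * e by rewrite !mulr_ge0.
have [eta0' dl0' dleta'] : [/\ 0 < eta, 0 < dl & dl <= eta / 4] by [].
have W0' : 0 <= W by [].
have vu := vdl p cu; have /andP[u0 u1] := cu p; have /andP[v0 v1] := vcube u p.
have Eb : `|b 0 p - a 0 p| = `|v u 0 p - u 0 p| by rewrite au bv.
have far_or_near : eta / 2 <= u 0 p <= 1 - eta / 2 \/
    exists b, (b = 0 \/ b = 1) /\ `|u 0 p - b| <= eta / 2.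
  have [h1|h1] := leP (eta / 2) (u 0 p); last first.
    by right; exists 0; split; [left | rewrite subr0 ger0_norm// ltW].
  have [h2|h2] := leP (u 0 p) (1 - eta / 2); first by left.
  right; exists 1; split; first by right.
  by rewrite distrC ger0_norm ?subr_ge0//; lra.
have eta2 : eta / 2 <= eta by rewrite ler_pdivrMr// ler_pMr// ler1n.
case: far_or_near => [/andP[f1 f2]|[c [c01 uc]]]; last first.
  have fu : `|f (1, margin_pt p u)| <= W.
    by apply: (margin_near_boundary cu c01); exact: le_trans uc eta2.
  have fv : `|f (1, margin_pt p (v u))| <= W.
    apply: (margin_near_boundary (vcube u) c01).
    rewrite -(subrKA (u 0 p)) (le_trans (ler_normD _ _))//.
    by move: uc vu dleta; lra.
  have d1 : `|Num.sqrt n%:R * (C b - C a)| <= 2 * W.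
    rewrite normrM gtr0_norm// distrC.
    apply: (le_trans (ler_wpM2l (ltW sn0) (Clip ca cb ab))).
    rewrite distrC Eb -[X in X * _](gtr0_norm sn0) -normrM shift//.
    by rewrite (le_trans (ler_normB _ _))//; have := excessW p cu; lra.
  have d2 : `|partialC C p u * f (1, margin_pt p u)| <= W.
    by rewrite normrM -[leRHS]mul1r ler_pM// dC1.
  by rewrite (le_trans (ler_normD _ _))//; lra.
have vu' : v u 0 p - u 0 p <= dl /\ u 0 p - v u 0 p <= dl.
  by move: vu; rewrite ler_norml => /andP[? ?]; split; lra.
case: vu' => vu1 vu2.
have au01 : 0 < a 0 p < 1 by rewrite au; apply/andP; split; lra.
have bv01 : 0 < b 0 p < 1 by rewrite bv; apply/andP; split; lra.
have [xi [cxi xia xip ->]] := dCmvt ca cb ab au01 bv01.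
have xib : u 0 p - dl <= xi 0 p <= u 0 p + dl.
  move: xip; rewrite au bv => /andP[h1 h2]; apply/andP; split.
    by apply: le_trans h1; rewrite le_min; apply/andP; split; lra.
  by apply: (le_trans h2); rewrite ge_max; apply/andP; split; lra.
case/andP: xib => xib1 xib2.
have dd : `|partialC C p xi - partialC C p u| <= e.
  apply: dCunif => //; [apply/andP; split; lra|apply/andP; split; lra|].
  move=> q; have [->|qp] := eqVneq q p; last by rewrite xia.
  by rewrite ler_norml; apply/andP; split; lra.
rewrite bv au (_ : Num.sqrt n%:R * _ + _ =
   (partialC C p xi - partialC C p u) * (Num.sqrt n%:R * (v u 0 p - u 0 p)) +
   partialC C p u * (Num.sqrt n%:R * (v u 0 p - u 0 p) + f (1, margin_pt p u)));
  last by ring.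
have d1 : `|(partialC C p xi - partialC C p u) *
    (Num.sqrt n%:R * (v u 0 p - u 0 p))| <= 3 * K * e.
  rewrite normrM mulrC ler_pM// normrM gtr0_norm//.
  exact: quantile_transform_shift.
have d2 : `|partialC C p u * (Num.sqrt n%:R * (v u 0 p - u 0 p) +
    f (1, margin_pt p u))| <= 2 * W.
  rewrite normrM -[leRHS]mul1r ler_pM ?dC1// shift//.
  rewrite -addrA [- _ + _]addrC (le_trans (ler_normD _ _))//.
  have := excessW p cu.
  have : `|f (1, margin_pt p u) - f (1, margin_pt p (v u))| <= W.
    apply: fW; [exact/scube1/margin_pt_cube|exact/scube1/margin_pt_cube|].
    apply: margin_pt_close; first exact: ltW.
    by rewrite distrC (le_trans vu)//; lra.
  by lra.
by rewrite (le_trans (ler_normD _ _))//; lra.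
Qed.

(** The coordinates of [u] are moved to those of [v u] one after the other, and
    the increments of [C] are added up. *)
Lemma Cproc_sharp_approx t : scube R dim t ->
  `|Cproc_sharp C n x t -
    (f t - t.1 * \sum_(p < dim) partialC C p t.2 * f (1, margin_pt p t.2))| <=
  (3 * dim%:R + 1) * W + dim%:R * (3 * K * e + K / n%:R).
Proof.
case: t => s u [/= s01 cu].
pose w (k : nat) : 'rV[R]_dim := \row_q if (q < k)%N then v u 0 q else u 0 q.
have cw k : cube R dim (w k).
  by move=> q; rewrite mxE; case: ifP => _; [exact: vcube | exact: cu].
have Cw : C (v u) - C u = \sum_(p < dim) (C (w p.+1) - C (w p)).
  rewrite -(big_mkord xpredT (fun p => C (w p.+1) - C (w p))) telescope_sumr//.
  congr (C _ - C _); apply/rowP => q; last by rewrite [RHS]mxE.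
  by rewrite [RHS]mxE ltn_ord.
have inc (p : 'I_dim) : `|Num.sqrt n%:R * (C (w p.+1) - C (w p)) +
    partialC C p u * f (1, margin_pt p u)| <= 3 * W + 3 * K * e.
  apply: coordinate_increment => //.
  - move=> q qp; rewrite !mxE; suff -> : (q < p.+1)%N = (q < p)%N by [].
    by rewrite ltnS leq_eqVlt (negbTE qp : (q == p :> nat) = false).
  - by rewrite mxE ltnn.
  - by rewrite mxE ltnSn.
  - move=> q; rewrite mxE; case: ifP => _; last by rewrite subrr normr0 ltW.
    exact: vdl.
have sM : (Num.sqrt n%:R)^-1 * (sfloor n s)%:R = lam s * Num.sqrt n%:R.
  rewrite /lam -{2}(sqrt_natrM n0); field.
  by rewrite !natr_sqrt_neq0.
rewrite (Cproc_sharpE C Fmono Fx)// -/f mulrA sM Cw.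
set S := \sum_(p < dim) partialC C p u * f (1, margin_pt p u).
rewrite (_ : _ - _ = (f (s, v u) - f (s, u)) +
   lam s * (\sum_(p < dim) (Num.sqrt n%:R * (C (w p.+1) - C (w p)) +
    partialC C p u * f (1, margin_pt p u))) + (s - lam s) * S); last first.
  by rewrite [X in _ = _ + lam s * X + _]big_split /= -/S -mulr_sumr; ring.
have sum_le (G : 'I_dim -> R) (b : R) : (forall p, `|G p| <= b) ->
    `|\sum_(p < dim) G p| <= dim%:R * b.
  move=> Gb; rewrite (le_trans (ler_norm_sum _ _ _))//.
  rewrite (le_trans (ler_sum _ (fun p _ => Gb p)))//.
  by rewrite sumr_const card_ord mulr_natl.
have h1 : `|f (s, v u) - f (s, u)| <= W.
  apply: fW; [by split => //; exact: vcube | by [] |].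
  split=> [|p]; first by rewrite subrr normr0 ltW.
  by apply: (le_trans (vdl p cu)); apply: (le_trans dleta); move: eta0; lra.
have h2 := sum_le _ _ inc.
have h3 : `|S| <= dim%:R * K.
  apply: sum_le => p; rewrite normrM -[leRHS]mul1r ler_pM ?dC1// fle//.
  exact/scube1/margin_pt_cube.
have /andP[l0 l1] := lam01 s01.
rewrite (le_trans (ler_normD _ _))//.
apply: (@le_trans _ _ ((W + dim%:R * (3 * W + 3 * K * e)) + n%:R^-1 * (dim%:R * K))).
  apply: lerD; last by rewrite normrM ler_pM// lamB.
  rewrite (le_trans (ler_normD _ _))// lerD// normrM -[leRHS]mul1r.
  by rewrite ler_pM// ger0_norm.
by rewrite le_eqVlt; apply/orP; left; apply/eqP; ring.
Qed.

End smooth.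
End deterministic_bounds.

(** * Uniform continuity on compact sets, and elementary properties of copulas *)

Lemma compact_unif_continuous {R : realType} {T : pseudoMetricType R}
    (K : set T) (f : T -> R) : compact K -> {within K, continuous f} ->
  forall e : R, 0 < e -> exists2 eta : R, 0 < eta &
    forall x y, K x -> K y -> ball x eta y -> `|f x - f y| <= e.
Proof.
move=> /compact_near_coveringP/near_covering_withinP cK.
move=> /subspace_continuousP cf e e0.
pose Q (eta : R) x := forall y, K y -> ball x eta y -> `|f x - f y| <= e.
have e20 : 0 < e / 2 by rewrite divr_gt0.
have H : \forall eta \near 0^'+, K `<=` Q eta.
  apply: cK => x Kx; have /cvgrPdist_le/(_ _ e20) := cf x Kx.
  rewrite near_withinE => /nbhs_ballP[r /= r0 hr].
  have r20 : 0 < r / 2 by rewrite divr_gt0.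
  exists (ball x (r / 2), [set eta : R | eta <= r / 2]).
    split => /=; first exact: nbhsx_ballx.
    exact: nbhs_right_le.
  move=> [x' eta] [/= xx' etar] Kx' y Ky x'y.
  have h1 := hr _ (le_ball (ltW _) xx') Kx'.
  have h2 : `|f x - f y| <= e / 2.
    apply: hr => //; rewrite [r]splitr; apply: ball_triangle xx' _.
    exact: le_ball x'y.
  have {}h1 : `|f x - f x'| <= e / 2.
    by apply: h1; rewrite ltr_pdivrMr// ltr_pMr// ltr1n.
  rewrite (_ : f x' - f y = (f x - f y) - (f x - f x')); last by ring.
  by rewrite (le_trans (ler_normB _ _))// [leRHS]splitr lerD.
have [eta [H1 eta0]] : ([set eta | K `<=` Q eta] `&` [set r | 0 < r]) !=set0.
  apply: (@filter_ex _ (0 : R)^'+); apply: filterI; first exact: H.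
  exact: nbhs_right_gt.
by exists eta => // x y Kx Ky; exact: H1.
Qed.

Section copula.
Context {R : realType} (dim : nat) (C : 'rV[R]_dim -> R).
Hypothesis hC : is_copula C.

Lemma uniform_prob_itv (a b : R) : 0 <= a -> a <= b -> b <= 1 ->
  uniform_prob (@ltr01 R) `]a, b] = (b - a)%:E.
Proof.
move=> a0 ab b1; rewrite /uniform_prob integral_uniform_pdf setIidl; last first.
  move=> x /=; rewrite !in_itv /= => /andP[ax xb].
  by rewrite (le_trans a0 (ltW ax)) (le_trans xb b1).
rewrite (eq_integral (fun=> 1%:E)); last first.
  move=> x; rewrite inE /= in_itv /= => /andP[ax xb].
  by rewrite /uniform_pdf (le_trans a0 (ltW ax)) (le_trans xb b1) subr0 invr1.
rewrite integral_cst//= lebesgue_measure_itv/= lte_fin mul1e.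
by move: ab; rewrite le_eqVlt => /predU1P[->|->]; [rewrite ltxx subrr|rewrite EFinB].
Qed.

Lemma uniform_prob_out (S : set R) : S `&` `[0, 1] `<=` [set 0] ->
  measurable S -> uniform_prob (@ltr01 R) S = 0%E.
Proof.
move=> S01 mS; rewrite /uniform_prob integral_uniform_pdf.
by have [->|->] := subset_set1 S01; rewrite ?integral_set0 ?integral_set1.
Qed.

Lemma measurable_le_vec (u : 'rV[R]_dim) :
  measurable [set x : dim.-tuple R | le_vec x u].
Proof.
rewrite (_ : [set _ | _] = \bigcap_(p in [set: 'I_dim])
    ((fun x : dim.-tuple R => tnth x p) @^-1` `]-oo, u 0 p])).
  apply: fin_bigcap_measurable; first exact: finite_finset.
  move=> p _; rewrite -[X in measurable X]setTI.
  by apply: measurable_tnth => //; exact: measurable_itv.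
apply/seteqP; split => x /= => [/forallP h p _|h]; first by rewrite /= in_itv /=.
by apply/forallP => p; have := h p I; rewrite /= in_itv.
Qed.

Section law.
Variable mu : probability (dim.-tuple R) R.
Hypothesis Cmu : forall u, cube R dim u ->
  C u = fine (mu [set x : dim.-tuple R | le_vec x u]).
Hypothesis mu_unif : forall (p : 'I_dim) (S : set R), measurable S ->
  mu ((fun x : dim.-tuple R => tnth x p) @^-1` S) = uniform_prob (@ltr01 R) S.

Let CE u : cube R dim u -> (C u)%:E = mu [set x : dim.-tuple R | le_vec x u].
Proof.
by move=> cu; rewrite Cmu// fineK// fin_num_measure//; exact: measurable_le_vec.
Qed.

Let mtnth p (S : set R) : measurable S ->
  measurable ((fun x : dim.-tuple R => tnth x p) @^-1` S).
Proof. by move=> mS; rewrite -[X in measurable X]setTI; exact: measurable_tnth. Qed.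

Let le_law (A S N : set (dim.-tuple R)) : measurable A -> measurable S ->
  measurable N -> A `<=` S `|` N -> (mu A <= mu S + mu N)%E.
Proof.
move=> mA mS mN AB; apply: (@le_trans _ _ (mu (S `|` N))).
  by apply: le_measure; rewrite ?inE//; exact: measurableU.
exact: measureU2.
Qed.

Lemma law_ge0 u : cube R dim u -> 0 <= C u <= 1.
Proof.
move=> cu; rewrite -!lee_fin CE// measure_ge0 probability_le1//.
exact: measurable_le_vec.
Qed.

(** Enlarging one coordinate adds a subset of a slab, whose mass is given by the
    uniform margin. *)
Lemma law_lip p u u' : cube R dim u -> cube R dim u' ->
  (forall q, q != p -> u 0 q = u' 0 q) -> `|C u - C u'| <= `|u 0 p - u' 0 p|.
Proof.
wlog uu' : u u' / u 0 p <= u' 0 p => [h cu cu' e|cu cu' e].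
  have [/h|/ltW/h] := leP (u 0 p) (u' 0 p); first exact.
  by rewrite distrC (distrC (u 0 p)); apply => // q /e.
have le1 : C u <= C u'.
  rewrite -lee_fin !CE//; apply: le_measure; rewrite ?inE; try exact: measurable_le_vec.
  move=> x /= /forallP h; apply/forallP => q; have := h q.
  have [->|qp] := eqVneq q p; last by rewrite e.
  by move=> /le_trans; apply.
have /andP[u0 _] := cu p; have /andP[_ u1] := cu' p.
have le2 : C u' <= C u + (u' 0 p - u 0 p).
  rewrite -lee_fin EFinD !CE// -(uniform_prob_itv u0 uu' u1) -(mu_unif p)//.
  apply: le_law; try exact: measurable_le_vec; first exact: mtnth.
  move=> x /= /forallP h; have [xu|xu] := leP (tnth x p) (u 0 p); [left|right].
    apply/forallP => q; have [->//|qp] := eqVneq q p.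
    by rewrite e.
  by rewrite in_itv /= xu h.
by rewrite distrC (distrC (u 0 p)) !ger0_norm ?subr_ge0// lerBlDl.
Qed.

Lemma law_margin p u : cube R dim u -> C (margin_pt p u) = u 0 p.
Proof.
move=> cu; have cm := margin_pt_cube p cu; have /andP[u0 u1] := cu p.
have u0E : u 0 p = u 0 p - 0 by rewrite subr0.
apply/eqP; rewrite eq_le -!lee_fin CE//; apply/andP; split.
  rewrite [in leRHS]u0E -(uniform_prob_itv (lexx 0) u0 u1) -(mu_unif p)//.
  have z : mu ((fun x : dim.-tuple R => tnth x p) @^-1` `]-oo, 0]) = 0%E.
    rewrite mu_unif// uniform_prob_out// => r /=; rewrite !in_itv /=.
    by move=> [r0 /andP[r0' _]]; apply/eqP; rewrite eq_le r0.
  rewrite -[leRHS]adde0 -[X in (_ + X)%E]z; apply: le_law.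
  - exact: measurable_le_vec.
  - exact: mtnth.
  - exact: mtnth.
  move=> x /= /forallP /(_ p); rewrite mxE eqxx !in_itv /= => xp.
  by have [xl|xl] := leP (tnth x p) 0; [right|left; rewrite xp].
have [N [mN N0 hN]] : {ae mu, forall x : dim.-tuple R, forall q, tnth x q <= 1}.
  apply: filter_forall => q.
  exists ((fun x : dim.-tuple R => tnth x q) @^-1` `]1, +oo[); split.
  - exact: mtnth.
  - rewrite mu_unif// uniform_prob_out// => r /=; rewrite !in_itv /= andbT.
    by move=> [r1 /andP[_]]; rewrite leNgt r1.
  - by move=> x /= /negP; rewrite in_itv /= andbT ltNge.
rewrite [in leLHS]u0E -(uniform_prob_itv (lexx 0) u0 u1) -(mu_unif p)//.
rewrite -[leRHS]adde0 -[X in (_ + X)%E]N0; apply: le_law => //.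
- exact: mtnth.
- exact: measurable_le_vec.
move=> x /=; rewrite in_itv /= => /andP[_ xp].
have [h|h] := pselect (forall q, tnth x q <= 1); [left|by right; apply: hN].
apply/forallP => q; rewrite mxE; have [->//|_] := eqVneq q p; exact: h.
Qed.

End law.

Lemma copula_ge0 u : cube R dim u -> 0 <= C u <= 1.
Proof. by case: hC => mu [Cmu _]; exact: law_ge0 Cmu u. Qed.

Lemma copula_lip p u u' : cube R dim u -> cube R dim u' ->
  (forall q, q != p -> u 0 q = u' 0 q) -> `|C u - C u'| <= `|u 0 p - u' 0 p|.
Proof. by case: hC => mu [Cmu mu_unif]; exact: law_lip Cmu mu_unif p u u'. Qed.

Lemma copula_margin p u : cube R dim u -> C (margin_pt p u) = u 0 p.
Proof. by case: hC => mu [Cmu mu_unif]; exact: law_margin Cmu mu_unif p u. Qed.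

End copula.

(** * Partial derivatives of a smooth copula *)

Section partial_derivatives.
Context {R : realType} (dim : nat) (C : 'rV[R]_dim -> R).
Hypotheses (hC : is_copula C) (sC : smooth_copula C).

Let along p (u : 'rV[R]_dim) (z : R) : 'rV[R]_dim :=
  \row_q (if q == p then z else u 0 q).

Let alongD p u z h :
  h *: (delta_mx 0 p : 'rV[R]_dim) + along p u z = along p u (h + z).
Proof.
apply/rowP => q; rewrite !mxE eqxx andTb.
by case: eqP => _; rewrite ?mulr1// mulr0 add0r.
Qed.

Let along_cube p u (z : R) : cube R dim u -> 0 <= z <= 1 -> cube R dim (along p u z).
Proof. by move=> cu z01 q; rewrite mxE; case: ifP. Qed.

Let along_id p (u u' : 'rV[R]_dim) : (forall q, q != p -> u 0 q = u' 0 q) ->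
  along p u (u' 0 p) = u'.
Proof.
by move=> e; apply/rowP => q; rewrite mxE; have [->//|qp] := eqVneq q p; exact: e.
Qed.

Let quotient_along p u z h :
  h^-1 *: ((C \o shift (along p u z)) (h *: delta_mx 0 p) - C (along p u z)) =
  h^-1 *: (((C \o along p u) \o shift z) (h *: 1) - (C \o along p u) z).
Proof. by rewrite /= /shift /= alongD /GRing.scale /= mulr1. Qed.

Let is_derive_along (p : 'I_dim) u (z : R) : cube R dim u -> 0 < z < 1 ->
  is_derive z 1 (C \o along p u) (partialC C p (along p u z)).
Proof.
move=> cu z01; have z01' : 0 <= z <= 1 by case/andP: z01 => *; rewrite !ltW.
have [sC1 _] := sC p.
have dC : derivable C (along p u z) (delta_mx 0 p).
  by apply: sC1; split; [exact: along_cube | rewrite /= mxE eqxx].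
rewrite /partialC mxE eqxx z01; split.
  move: dC; rewrite /derivable.
  by under eq_fun do rewrite quotient_along.
by rewrite /derive; under [in RHS]eq_fun do rewrite quotient_along.
Qed.

(** The difference quotients are bounded by 1, as [C] is 1-Lipschitz in each
    coordinate. *)
Lemma partialC_bounded p u : cube R dim u -> `|partialC C p u| <= 1.
Proof.
move=> cu; have [u01|] := boolP (0 < u 0 p < 1); last first.
  by move=> /negbTE h; rewrite /partialC h normr0.
have [sC1 _] := sC p; have := sC1 u (conj cu u01).
rewrite /partialC u01 /derive /derivable => dC.
have /andP[u0 u1] := u01.
have e0 : 0 < Num.min (u 0 p) (1 - u 0 p) by rewrite lt_min u0 subr_gt0.
have H : \forall h \near 0^',
    `|h^-1 *: ((C \o shift u) (h *: delta_mx 0 p) - C u)| <= 1.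
  near=> h.
  have h0 : h != 0 by near: h; exact: nbhs_dnbhs_neq.
  have hm : `|h| < Num.min (u 0 p) (1 - u 0 p).
    by near: h; apply: dnbhs0_lt.
  move: hm; rewrite lt_min !ltr_norml => /andP[/andP[h1 _] /andP[_ h2]].
  have uE : u = along p u (u 0 p) by rewrite along_id.
  rewrite /= /shift /= [X in C (_ + X)]uE alongD normrM normfV.
  rewrite ler_pdivrMl ?normr_gt0// mulr1.
  apply: (le_trans (copula_lip hC (p := p) _ cu _)).
  - by apply: along_cube => //; apply/andP; split; lra.
  - by move=> q /negbTE qp; rewrite mxE qp.
  - by rewrite mxE eqxx addrK.
rewrite ler_norml; apply/andP; split.
  by apply: limr_ge => //; apply: filterS H => h; rewrite ler_norml => /andP[].
by apply: limr_le => //; apply: filterS H => h; rewrite ler_norml => /andP[].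
Unshelve. all: by end_near. Qed.

Lemma partialC_mvt p u u' : cube R dim u -> cube R dim u' ->
  (forall q, q != p -> u 0 q = u' 0 q) -> 0 < u 0 p < 1 -> 0 < u' 0 p < 1 ->
  exists xi, [/\ cube R dim xi, forall q, q != p -> xi 0 q = u 0 q,
    Num.min (u 0 p) (u' 0 p) <= xi 0 p <= Num.max (u 0 p) (u' 0 p) &
    C u' - C u = partialC C p xi * (u' 0 p - u 0 p)].
Proof.
wlog uu' : u u' / u 0 p <= u' 0 p => [h cu cu' e u01 u01'|cu cu' e u01 u01'].
  have /orP[/h|u'u] := le_total (u 0 p) (u' 0 p); first by apply.
  have e' q : q != p -> u' 0 q = u 0 q by move/e.
  have [xi [cxi xiE xib xid]] := h _ _ u'u cu' cu e' u01' u01.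
  exists xi; split => //.
  - by move=> q qp; rewrite xiE// e.
  - by rewrite minC maxC.
  - by rewrite -opprB xid -mulrN opprB.
have /andP[u0 u1] := u01; have /andP[u0' u1'] := u01'.
have dg (z : R) : u 0 p <= z <= u' 0 p ->
    is_derive z 1 (C \o along p u) (partialC C p (along p u z)).
  move=> /andP[h1 h2]; apply: is_derive_along => //.
  by rewrite (lt_le_trans u0 h1) (le_lt_trans h2 u1').
have [||z] := @MVT_segment _ (C \o along p u)
    (fun z => partialC C p (along p u z)) _ _ uu'.
- by move=> z; rewrite in_itv /= => /andP[h1 h2]; apply: dg; rewrite !ltW.
- apply: derivable_within_continuous => z; rewrite in_itv /= => /dg.
  by move=> dz; exact: ex_derive.
rewrite in_itv /= => /andP[h1 h2] gE.
exists (along p u z); split.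
- by apply: along_cube => //; rewrite (le_trans (ltW u0) h1) (le_trans h2 (ltW u1')).
- by move=> q /negbTE qp; rewrite mxE qp.
- by rewrite mxE eqxx min_l// max_r// h1.
- by move: gE; rewrite !along_id.
Qed.

(** On the slab where the coordinate [p] stays away from 0 and 1, which is
    compact, this is Heine's theorem; the moduli for the finitely many [p] are
    combined by taking their minimum. *)
Lemma partialC_unif_continuous (eta e : R) : 0 < eta -> 0 < e ->
  exists2 dl : R, 0 < dl & forall p u u', cube R dim u -> cube R dim u' ->
    eta <= u 0 p <= 1 - eta -> eta <= u' 0 p <= 1 - eta ->
    (forall q, `|u 0 q - u' 0 q| <= dl) ->
    `|partialC C p u - partialC C p u'| <= e.
Proof.
move=> eta0 e0.
pose K p : set 'rV[R]_dim := [set u | forall q,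
  (if q == p then `[eta, 1 - eta] else `[0, 1])%classic (u 0 q)].
have KP p u : cube R dim u -> eta <= u 0 p <= 1 - eta -> K p u.
  move=> cu h q; have [->|_] := eqVneq q p; first by rewrite /= in_itv.
  by rewrite /= in_itv; exact: cu.
have H p : exists2 dl : R, 0 < dl & forall u u', K p u -> K p u' ->
    ball u dl u' -> `|partialC C p u - partialC C p u'| <= e.
  apply: (@compact_unif_continuous R 'rV[R]_dim (K p) (partialC C p)) => //.
    apply: (@rV_compact R dim (fun q => if q == p then `[eta, 1 - eta]%classic
      else `[0, 1]%classic)) => q.
    by case: ifP => _; exact: segment_compact.
  have [_ sC2] := sC p; apply: continuous_subspaceW sC2 => u Ku.
  have := Ku p; rewrite eqxx /= in_itv /= => /andP[up1 up2]; split; last first.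
    by rewrite /= (lt_le_trans eta0 up1) (le_lt_trans up2)// ltrBlDr ltrDl.
  move=> q; have := Ku q; have [->|_] := eqVneq q p; rewrite /= in_itv //=.
  move=> /andP[h1 h2]; rewrite (le_trans (ltW eta0) h1) (le_trans h2)//.
  by rewrite lerBlDr lerDl ltW.
pose dl (p : 'I_dim) : R := sval (cid2 (H p)).
have dl0 p : 0 < dl p by rewrite /dl; case: cid2.
have Hdl p u u' : K p u -> K p u' -> ball u (dl p) u' ->
    `|partialC C p u - partialC C p u'| <= e.
  by rewrite /dl; case: cid2 => r r0 hr; exact: hr.
pose m := \big[Num.min/1]_(p < dim) dl p.
have m0 : 0 < m by rewrite /m; elim/big_ind: _ => // a b a0 b0; rewrite lt_min a0.
have m20 : m / 2 < m by rewrite ltr_pdivrMr// ltr_pMr// ltr1n.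
exists (m / 2) => [|p u u' cu cu' up up' uu']; first by rewrite divr_gt0.
apply: Hdl; [exact: KP|exact: KP|].
have mdl : m <= dl p by rewrite /m (bigD1 p)//= ge_min lexx.
split=> // i q; rewrite (ord1 i) /ball /=.
by rewrite (le_lt_trans (uu' q))// (lt_le_trans m20 mdl).
Qed.

End partial_derivatives.

(** * Stationary sequences with continuous margins *)

Section continuous_margins.
Context {R : realType} (dim : nat) (dO : measure_display)
  (Omega : measurableType dO) (P : probability Omega R)
  (X : int -> {RV P >-> dim.-tuple R}).
Hypothesis hX : strictly_stationary P X.

Local Notation F := (marginal_cdf P (X 0)).

Lemma measurable_margin i p (S : set R) : measurable S ->
  measurable [set w | S (tnth (X i w) p)].
Proof.
move=> mS; rewrite -[X in measurable X]setTI.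
by apply: (measurableT_comp (measurable_tnth p) (measurable_funP (X i))).
Qed.

Lemma measurable_margin_le i p (y : R) : measurable [set w | tnth (X i w) p <= y].
Proof.
have := @measurable_margin i p `]-oo, y] (measurable_itv _).
by congr measurable; apply/seteqP; split => w /=; rewrite in_itv.
Qed.

Lemma marginal_cdfE p y : (F p y)%:E = P [set w | tnth (X 0 w) p <= y].
Proof. by rewrite fineK// fin_num_measure//; exact: measurable_margin_le. Qed.

Lemma marginal_cdf_mono p : {homo F p : y z / y <= z}.
Proof.
move=> y z yz; rewrite -lee_fin !marginal_cdfE.
apply: le_measure; rewrite ?inE; try exact: measurable_margin_le.
by move=> w /= /le_trans; apply.
Qed.

Lemma marginal_cdf01 p y : 0 <= F p y <= 1.
Proof.
rewrite -!lee_fin marginal_cdfE measure_ge0 probability_le1//.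
exact: measurable_margin_le.
Qed.

Lemma stationary_margin i (S : set (dim.-tuple R)) : measurable S ->
  P (X i @^-1` S) = P (X 0 @^-1` S).
Proof.
move=> mS; pose S' := (fun y : 1.-tuple (dim.-tuple R) => tnth y ord0) @^-1` S.
have mS' : measurable S'.
  by rewrite /S' -[X in measurable X]setTI; exact: measurable_tnth.
have := hX (fun=> 0) i mS'; rewrite /S' /preimage /=.
have e (j : int) : [set w | S (tnth [tuple X j w | _ < 1] ord0)] = X j @^-1` S.
  by apply/seteqP; split => w /=; rewrite tnth_mktuple.
by rewrite !e add0r.
Qed.

Lemma margin_itv_prob i p (q s : R) : q <= s ->
  P [set w | q < tnth (X i w) p <= s] = (F p s - F p q)%:E.
Proof.
move=> qs; have mq := @measurable_margin_le 0 p q.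
have ms := @measurable_margin_le 0 p s.
have mS : measurable ((fun y : dim.-tuple R => tnth y p) @^-1` `]q, s]).
  by rewrite -[X in measurable X]setTI; exact: measurable_tnth.
have -> : [set w | q < tnth (X i w) p <= s] =
    X i @^-1` ((fun y : dim.-tuple R => tnth y p) @^-1` `]q, s]).
  by apply/seteqP; split => w /=; rewrite in_itv.
rewrite stationary_margin// EFinB !marginal_cdfE.
rewrite (_ : _ @^-1` _ =
    [set w | tnth (X 0 w) p <= s] `\` [set w | tnth (X 0 w) p <= q]).
  rewrite measureD//; last by rewrite -ge0_fin_numE// fin_num_measure.
  congr (_ - P _)%E; apply: setIidr => w /= /le_trans; exact.
apply/seteqP; split => w /=; rewrite in_itv /=.
  by move=> /andP[h1 h2]; split=> //; apply/negP; rewrite -ltNge.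
by move=> [h1 /negP]; rewrite -ltNge => ->.
Qed.

Hypothesis hF : forall p, continuous (F p).

(* [F p] is still equal to [F p q] at the supremum of the level set by
   continuity, so the level set has the mass of an interval between two points
   where [F p] agrees. *)
Let flat_null (i : nat) p (q k : R) :
  {ae P, forall w, q < tnth (X i%:Z w) p <= k -> F p q < F p (tnth (X i%:Z w) p)}.
Proof.
have [qk|kq] := leP q k; last first.
  apply: nearW => w /andP[h1 h2].
  by have := lt_le_trans h1 h2; rewrite ltNge ltW.
pose S := [set y | q <= y <= k /\ F p y = F p q].
have hS : has_sup S.
  by split; [exists q; rewrite /S /= lexx qk|exists k => y [/andP[]]].
set s := sup S.
have qs : q <= s by apply: sup_upper_bound => //; rewrite /S /= lexx qk.
have Fs : F p s = F p q.
  apply/eqP; rewrite eq_le; apply/andP; split; last exact: marginal_cdf_mono.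
  apply/ler_addgt0Pr => e e0.
  have /cvgrPdist_le/(_ _ e0)/nbhs_ballP[dl /= dl0 hdl] := @hF p s.
  have [y Sy ys] := sup_adherent dl0 hS.
  have ys' : y <= s by exact: sup_upper_bound.
  have /hdl : ball s dl y.
    by rewrite /ball /= ger0_norm ?subr_ge0//; rewrite ltrBlDr -ltrBlDl.
  case: Sy => _ ->; rewrite ler_norml => /andP[_]; rewrite lerBlDl.
  by rewrite addrC.
exists [set w | q < tnth (X i%:Z w) p <= s]; split.
- have := @measurable_margin i%:Z p `]q, s] (measurable_itv _).
  by congr measurable; apply/seteqP; split => w /=; rewrite in_itv.
- by rewrite margin_itv_prob// Fs subrr.
- move=> w /= /not_implyP[/andP[h1 h2] h3]; rewrite h1 /=.
  apply: sup_upper_bound => //; split; first by rewrite ltW.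
  apply/eqP; rewrite eq_le; apply/andP; split; last first.
    by apply: marginal_cdf_mono; exact: ltW.
  by rewrite leNgt; apply/negP.
Qed.

(** A flat stretch of [F p] below an observation contains a rational, so the
    exceptional set is a countable union of null sets. *)
Lemma margin_strict_ae : {ae P, forall w, forall (i : nat) p y,
  y < tnth (X i%:Z w) p -> F p y < F p (tnth (X i%:Z w) p)}.
Proof.
have H : {ae P, forall w, forall (i m k : nat) p,
    if unpickle m is Some q then ratr (q : rat) < tnth (X i%:Z w) p <= k%:R ->
      F p (ratr q) < F p (tnth (X i%:Z w) p) else True}.
  apply: ae_foralln => i; apply: ae_foralln => m; apply: ae_foralln => k.
  apply: filter_forall => p.
  by case: (unpickle m) => [q|]; [exact: flat_null | exact: nearW].
apply: (filterS _ H) => w {}H i p y yx.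
have [q qy] := rat_in_itvoo yx; rewrite in_itv /= in qy; case/andP: qy => yq qx.
apply: (@le_lt_trans _ _ (F p (ratr q))); first exact/marginal_cdf_mono/ltW.
have := H i (pickle q) (Num.truncn (tnth (X i%:Z w) p)).+1 p.
rewrite pickleK; apply; rewrite qx /=.
by rewrite ltW// truncnS_gt.
Qed.

End continuous_margins.

(** * The limit maps and the main theorem *)

Section limit_maps.
Context {R : realType} (dim : nat).
Local Notation A := (scube R dim).

Lemma scube_end t : A t -> A (1, t.2).
Proof. by case=> _ ct; split => //=; rewrite ler01 lexx. Qed.

Lemma scube_margin p t : A t -> A (1, margin_pt p t.2).
Proof.
by case=> _ ct; split => /=; [rewrite ler01 lexx | exact: margin_pt_cube].
Qed.

Lemma linfty_lip_of_bound (L : R) (Phi : (R * 'rV[R]_dim -> R) -> _) : 0 <= L ->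
  (forall t, Phi (fun=> 0) t = 0) ->
  (forall f g b, 0 <= b -> (forall t, A t -> `|f t - g t| <= b) ->
    forall t, A t -> `|Phi f t - Phi g t| <= L * b) ->
  linfty_lip A L Phi.
Proof.
move=> L0 Phi0 H; split.
  move=> f /linftyP[M fM]; apply/linftyP; exists (L * `|M|) => t At.
  rewrite -[Phi f t]subr0 -(Phi0 t); apply: H => // s As.
  by rewrite subr0 (le_trans (fM s As))// ler_norm.
move=> f g lf lg; apply: supnorm_le; first by rewrite mulr_ge0// supnorm_ge0.
apply: H => [|t At]; first exact: supnorm_ge0.
by apply: (@le_supnorm _ _ _ (fun t => f t - g t)) => //; exact: linftyB.
Qed.

Definition plus_map (f : R * 'rV[R]_dim -> R) (t : R * 'rV[R]_dim) : R :=
  f t - t.1 * f (1, t.2).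

Lemma plus_map_lip : linfty_lip A 2 plus_map.
Proof.
apply: linfty_lip_of_bound => // [t|f g b b0 fg t At].
  by rewrite /plus_map mulr0 subr0.
rewrite (_ : _ - _ = (f t - g t) - t.1 * (f (1, t.2) - g (1, t.2))); last first.
  by rewrite /plus_map; ring.
rewrite (le_trans (ler_normB _ _))// mulr_natl mulr2n lerD ?fg//.
rewrite normrM -[leRHS]mul1r ler_pM// ?fg//; last exact: scube_end.
by case: At => /andP[t0 t1] _; rewrite ger0_norm.
Qed.

Variable C : 'rV[R]_dim -> R.

Definition sharp_map (f : R * 'rV[R]_dim -> R) (t : R * 'rV[R]_dim) : R :=
  f t - t.1 * \sum_(p < dim) partialC C p t.2 * f (1, margin_pt p t.2).

Lemma sharp_map_lip : (forall p u, cube R dim u -> `|partialC C p u| <= 1) ->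
  linfty_lip A (1 + dim%:R) sharp_map.
Proof.
move=> dC1; apply: linfty_lip_of_bound => // [t|f g b b0 fg t At].
  by rewrite /sharp_map big1 ?mulr0 ?subr0// => p _; rewrite mulr0.
rewrite (_ : _ - _ = (f t - g t) - t.1 * \sum_(p < dim)
    partialC C p t.2 * (f (1, margin_pt p t.2) - g (1, margin_pt p t.2))); last first.
  under [in RHS]eq_bigr do rewrite mulrBr.
  by rewrite /sharp_map sumrB; ring.
rewrite (le_trans (ler_normB _ _))// mulrDl mul1r lerD ?fg//.
rewrite normrM -[leRHS]mul1r; have [/andP[t0 t1] ct] := At.
apply: ler_pM => //; first by rewrite ger0_norm.
apply: (le_trans (ler_norm_sum _ _ _)).
apply: (@le_trans _ _ (\sum_(p < dim) b)); last first.
  by rewrite sumr_const card_ord mulr_natl.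
apply: ler_sum => p _; rewrite normrM -[leRHS]mul1r.
by apply: ler_pM => //; [exact: dC1 | apply: fg; exact: scube_margin].
Qed.

Lemma compact_scube : compact A.
Proof.
apply: compact_setX.
  rewrite (_ : [set x | _] = `[0, 1]%classic); first exact: segment_compact.
  by apply/seteqP; split => x /=; rewrite in_itv.
rewrite (_ : cube R dim = [set u | forall p, `[0, 1]%classic (u 0 p)]).
  exact: (@rV_compact R dim (fun=> `[0, 1]%classic) (fun=> @segment_compact R 0 1)).
by apply/seteqP; split => u /= h p; have := h p; rewrite /= in_itv.
Qed.

Lemma D0sharp_unif_continuous (a : R * 'rV[R]_dim -> R) : D0sharp a ->
  forall e : R, 0 < e -> exists2 eta, 0 < eta & forall x y, A x -> A y ->
    close eta x y -> `|a x - a y| <= e.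
Proof.
move=> [ca _ _] e e0.
have [eta eta0 H] := compact_unif_continuous compact_scube ca e0.
have eta20 : 0 < eta / 2 by rewrite divr_gt0.
have eta2 : eta / 2 < eta by rewrite ltr_pdivrMr// ltr_pMr// ltr1n.
exists (eta / 2) => // x y Ax Ay [xy1 xy2]; apply: H => //; split.
  by rewrite /ball /= (le_lt_trans xy1).
by split=> // i p; rewrite (ord1 i) /ball /= (le_lt_trans (xy2 p)).
Qed.

Lemma close_le (eta eta' : R) (x y : R * 'rV[R]_dim) :
  eta <= eta' -> close eta x y -> close eta' x y.
Proof. by move=> h [h1 h2]; split=> [|p]; apply: le_trans h. Qed.

End limit_maps.

(** Linear combinations of the image are linear combinations of the field over
    twice as many points. *)
Lemma gaussian_plus_map {R : realType} (dim : nat) d (O : measurableType d)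
    (P : probability O R) (B : O -> R * 'rV[R]_dim -> R) :
  gaussian_field (scube R dim) P B ->
  gaussian_field (scube R dim) P (fun w => plus_map (B w)).
Proof.
move=> hB k t c At.
pose t' (i : 'I_(k + k)) := match fintype.split i with
  | inl j => t j | inr j => (1, (t j).2) end.
pose c' (i : 'I_(k + k)) := match fintype.split i with
  | inl j => c j | inr j => - (c j * (t j).1) end.
have At' i : scube R dim (t' i).
  by rewrite /t'; case: fintype.split => j; [exact: At | exact/scube_end/At].
have := hB _ t' c' At'; congr gaussian_rv; apply/funext => w.
rewrite big_split_ord /= -big_split /=; apply: eq_bigr => j _.
rewrite /t' /c' (unsplitK (inl j)) (unsplitK (inr j)) /=.
by rewrite /plus_map; ring.
Qed.

Section bounds.
Context {R : realType} (dim : nat).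
Implicit Types (x : int -> dim.-tuple R) (C : 'rV[R]_dim -> R).

(** A deterministic bound makes the exceptional events empty. *)
Lemma unif_bigOP_det {T : choiceType} (A : set T) d (O : measurableType d)
    (P : probability O R) (Z : nat -> O -> T -> R) (a : nat -> R) :
  (\forall n \near \oo, forall w t, A t -> `|Z n w t| <= a n) ->
  unif_bigOP A P Z a.
Proof.
move=> H e e0; exists 1; apply: filterS H => n Zn.
apply: (@le_trans _ _ (P set0)); last by rewrite measure0 lee_fin ltW.
apply: ereal_inf_lbound; exists set0 => //; split => // w /=.
rewrite mul1r ltNge => /negP; apply; apply: ge_ereal_sup => _ [t At <-].
by rewrite lee_fin; exact: Zn.
Qed.

(** Replacing [floor (s n)] by [s n] in the centering changes it by at most one
    term. *)
Lemma centering_error n (s c : R) (a : nat -> R) : (0 < n)%N ->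
  0 <= s <= 1 -> 0 <= c <= 1 ->
  `|(Num.sqrt n%:R)^-1 * (\sum_(1 <= i < (sfloor n s).+1) (a i - c)) -
    Num.sqrt n%:R * (n%:R^-1 * (\sum_(1 <= i < (sfloor n s).+1) a i) - s * c)|
  <= (Num.sqrt n%:R)^-1.
Proof.
move=> n0 s01 /andP[c0 c1]; rewrite sum_sub_const.
have := sfloor_le n s01; have := sfloor_gt n s; have := sqrt_natrM (R := R) n0.
have [nn sn] := natr_sqrt_neq0 (R := R) n0.
set k := (sfloor n s)%:R; set S := \sum_(_ <= _ < _) _ => sM h1 h2.
rewrite (_ : _ - _ = (Num.sqrt n%:R)^-1 * (c * (s * n%:R - k))); last first.
  by rewrite -[X in _ - X * _]sM; field; rewrite nn sn.
rewrite normrM ger0_norm ?invr_ge0// -[leRHS]mulr1 ler_wpM2l ?invr_ge0//.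
rewrite normrM !ger0_norm ?subr_ge0// -[leRHS]mul1r ler_pM// ?subr_ge0//.
by rewrite lerBlDl ltW.
Qed.

Lemma emp_copula01 n x u : 0 <= emp_copula n x u <= 1.
Proof.
rewrite /emp_copula /emp_df mulr_ge0 ?invr_ge0 ?sumr_ge0//=.
case: n => [|n]; first by rewrite invr0 mul0r.
rewrite ler_pdivrMl ?ltr0n// mulr1.
apply: (@le_trans _ _ (\sum_(1 <= i < n.+2) (1 : R))).
  by apply: ler_sum => i _; rewrite lern1 leq_b1.
by rewrite sumr_const_nat subn1.
Qed.

Lemma linfty_centered n (a : nat -> 'rV[R]_dim -> bool) (c : 'rV[R]_dim -> R) :
  (forall u, cube R dim u -> 0 <= c u <= 1) ->
  linfty (scube R dim) (fun t => (Num.sqrt n%:R)^-1 *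
    \sum_(1 <= i < (sfloor n t.1).+1) ((a i t.2)%:R - c t.2)).
Proof.
move=> c01; apply/linftyP; exists ((Num.sqrt n%:R)^-1 * n%:R) => -[s u] [/= s01 cu].
rewrite normrM ger0_norm ?invr_ge0// ler_wpM2l ?invr_ge0//.
apply: (le_trans (ler_norm_sum _ _ _)).
apply: (@le_trans _ _ (\sum_(1 <= i < (sfloor n s).+1) (1 : R))).
  apply: ler_sum => i _; have /andP[c0 c1] := c01 u cu.
  by rewrite ler_norml; case: (a i u) => /=; apply/andP; split; lra.
by rewrite sumr_const_nat subn1 ler_nat; exact: sfloor_leq.
Qed.

Lemma near_sqrt_ge (T : R) : \forall n \near \oo, (0 < n)%N /\
  T <= Num.sqrt n%:R :> R.
Proof.
exists (Num.truncn (T ^+ 2)).+1 => // n /= Tn; split; first exact: leq_trans Tn.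
apply: (le_trans (ler_norm _)); rewrite -sqrtr_sqr; apply: ler_wsqrtr.
by rewrite (le_trans (ltW (truncnS_gt _)))// ler_nat.
Qed.

Lemma sqrt_natr_le n : Num.sqrt n%:R <= n%:R :> R.
Proof.
case: n => [|n]; first by rewrite sqrtr0.
rewrite -[leRHS]ger0_norm// -sqrtr_sqr; apply: ler_wsqrtr.
by rewrite expr2 ler_peMr// ler1n.
Qed.

End bounds.

Unset Implicit Arguments.

Theorem corollary3p3 (R : realType) (dim : nat) (hdim : (2 <= dim)%N)
  (dO : measure_display) (Omega : measurableType dO) (P : probability Omega R)
  (X : int -> {RV P >-> dim.-tuple R})
  (hX : strictly_stationary P X)
  (hF : forall p : 'I_dim, continuous (marginal_cdf P (X 0) p))
  (C : 'rV[R]_dim -> R) (hC : is_copula_of P (X 0) C)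
  (dO' : measure_display) (Omega' : measurableType dO')
  (P' : probability Omega' R) (B : Omega' -> R * 'rV[R]_dim -> R)
  (htight : tight_map (scube R dim) P' B)
  (hgauss : gaussian_field (scube R dim) P' B)
  (hcent : centered_field (scube R dim) P' B)
  (hconc : {ae P', forall w, D0sharp (B w)})
  (hcvg : weak_cvg_linfty (scube R dim) P (alpha_sharp P X C) P' B) :
  let Cn_sharp n w := seq_emp_copula n (fun i => X i w) in
  let Cn n w := emp_copula n (fun i => X i w) in
  let CC_sharp n w := Cproc_sharp C n (fun i => X i w) in
  let CC_plus n w := Cproc_plus n (fun i => X i w) in
  let GC_plus w (t : R * 'rV[R]_dim) := B w t - t.1 * B w (1, t.2) in
  let GC_sharp w (t : R * 'rV[R]_dim) :=
    B w t - t.1 * \sum_(p < dim) partialC C p t.2 * B w (1, margin_pt p t.2) in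
  [/\ unif_bigOP (scube R dim) P
        (fun n w t => CC_plus n w t
           - Num.sqrt n%:R * (Cn_sharp n w t - t.1 * Cn n w t.2))
        (fun n => (Num.sqrt n%:R)^-1),
      weak_cvg_linfty (scube R dim) P CC_plus P' GC_plus &
      gaussian_field (scube R dim) P' GC_plus] /\
  (smooth_copula C ->
     unif_bigOP (scube R dim) P
       (fun n w t => CC_sharp n w t
          - Num.sqrt n%:R * (Cn_sharp n w t - t.1 * C t.2))
       (fun n => (Num.sqrt n%:R)^-1) /\
     weak_cvg_linfty (scube R dim) P CC_sharp P' GC_sharp).
Proof.
move=> Cn_sharp Cn CC_sharp CC_plus GC_plus GC_sharp.
have [hcop _] := hC.
have [lalpha _ _ _] := hcvg.
have Fmono := marginal_cdf_mono X.
have F01 := marginal_cdf01 X.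
have Cmargin := copula_margin hcop.
have Bunif : {ae P', forall w, forall e : R, 0 < e ->
    exists2 eta, 0 < eta & forall x y, scube R dim x -> scube R dim y ->
    close eta x y -> `|B w x - B w y| <= e}.
  by apply: (filterS _ hconc) => w; exact: D0sharp_unif_continuous.
have near0 : \forall n \near \oo, (0 < n)%N by exists 1%N.
split; first split.
- apply: unif_bigOP_det; apply: filterS near0 => n n0 w [s u] [/= s01 cu].
  by apply: centering_error => //; exact: emp_copula01.
- apply: (weak_cvg_linfty_approx hcvg (@close_le _ _) Bunif _ _ _ (plus_map_lip _)
    (c := 2)) => //.
    move=> n w; pose x i := X i w.
    exact: (@linfty_centered _ _ n
      (fun i u => le_vec (x i%:Z) (emp_quantile n x u)) (emp_copula n x)
      (fun u _ => emp_copula01 n x u)).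
  move=> K eta e eta0 e0.
  have := near_sqrt_ge (Num.max (3 * K / eta) (K / e)).
  apply: filterS => n [n0]; rewrite ge_max => /andP[K1 K2].
  apply: (filterS _ (margin_strict_ae hX hF)) => w Fx fK t At.
  apply: (le_trans (Cproc_plus_approx Fmono F01 hF Fx Cmargin n0 eta0
    (lalpha n w) fK At _)).
    by rewrite [leRHS]mulrC -ler_pdivrMr.
  rewrite lerD2l ler_pdivrMr ?ltr0n// mulrC -ler_pdivrMr//.
  exact: le_trans K2 (sqrt_natr_le _).
- exact: gaussian_plus_map.
move=> sC; have dC1 := partialC_bounded hcop sC; split.
  apply: unif_bigOP_det; apply: filterS near0 => n n0 w [s u] [/= s01 cu].
  by apply: centering_error => //; exact: copula_ge0.
apply: (weak_cvg_linfty_approx hcvg (@close_le _ _) Bunif _ _ _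
  (sharp_map_lip dC1) (c := 3 * dim%:R + 1)) => //.
- move=> n w; pose x i := X i w.
  exact: (@linfty_centered _ _ n
    (fun i u => le_vec (x i%:Z) (emp_quantile n x u)) C (copula_ge0 hcop)).

move=> K0 eta e eta0 e0; pose K := `|K0| + 1.
have K0K : K0 <= K by rewrite (le_trans (ler_norm _))// lerDl.
have Kp : 0 < K by rewrite ltr_wpDl.
have d0 : 0 < dim%:R + 1 :> R by rewrite ltr_wpDl.
(* chosen so that [dim * (3 * K * e' + K / n)] is at most [e] for large [n],
   with at most half of it from each term *)
pose e' := e / (6 * (dim%:R + 1) * K).
have e'0 : 0 < e' by rewrite divr_gt0// !mulr_gt0.
have eta40 : 0 < eta / 4 by rewrite divr_gt0.
have [dl' dl'0 Hdl'] := partialC_unif_continuous sC eta40 e'0.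
pose dl := Num.min dl' (eta / 4).
have dl0 : 0 < dl by rewrite lt_min dl'0.
have := near_sqrt_ge (Num.max (3 * K / dl) (K / (e / (2 * (dim%:R + 1))))).
apply: filterS => n [n0]; rewrite ge_max => /andP[K1 K2].
apply: (filterS _ (margin_strict_ae hX hF)) => w Fx fK t At.
have {}fK := le_trans fK K0K.
apply: (le_trans (Cproc_sharp_approx Fmono F01 hF Fx Cmargin n0 eta0
    (lalpha n w) fK (copula_lip hcop) dC1 (partialC_mvt sC) (ltW e'0)
    dl0 _ _ _ At)).
- by rewrite ge_min lexx orbT.
- move=> p u u' cu cu' up up' uu'; apply: Hdl' => // q.
  by rewrite (le_trans (uu' q))// ge_min lexx.
- by rewrite [leRHS]mulrC -ler_pdivrMr.
rewrite lerD2l.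
have Kn : K / n%:R <= e / (2 * (dim%:R + 1)).
  rewrite ler_pdivrMr ?ltr0n// mulrC -ler_pdivrMr ?divr_gt0 ?mulr_gt0//.
  exact: le_trans K2 (sqrt_natr_le _).
have Ke : 3 * K * e' = e / (2 * (dim%:R + 1)).
  by rewrite /e'; field; rewrite !gt_eqF.
apply: (@le_trans _ _ (dim%:R * (e / (dim%:R + 1)))).
  rewrite ler_wpM2l//.
  have -> : e / (dim%:R + 1) = e / (2 * (dim%:R + 1)) + e / (2 * (dim%:R + 1)).
    by field; rewrite gt_eqF.
  by rewrite Ke lerD2l.
by rewrite mulrA ler_pdivrMr// mulrC ler_wpM2l ?ltW// ltrDl.
Qed.
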